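(* For every entangled bipartite state $\rho$, $$\frac{E_D(\rho)}{E_c(\rho)}\le \mathcal S_E^{as}(\rho)\le 1,$$ equivalently $\dfrac{E_b(\rho)}{E_c(\rho)}\ge\mathcal A_E^{as}(\rho)$, where $E_b=E_c-E_D$. In particular, if $\mathcal A_E^{as}(\rho)>0$ then $E_D(\rho)<E_c(\rho)$.
   Context: $V$ is the swap of subsystems, $V(x\otimes y)=y\otimes x$. For bipartite states $\rho,\sigma$, the transition rate $R(\rho\to\sigma)$ is the supremum of all $r\ge0$ such that there exist LOCC operations $\Lambda_n$ and integers $m_n$ with $m_n/n\to r$ and $\|\Lambda_n(\rho^{\otimes n})-\sigma^{\otimes m_n}\|_1\to0$. The round-trip rate is $R(\rho\rightleftharpoons\sigma)=R(\rho\to\sigma)R(\sigma\to\rho)$ with $0\cdot\infty=\infty\cdot0=0$. The symmetry of entanglement is $\mathcal S_E^{as}(\rho)=R(\rho\to V\rho V^\dagger)$, which equals $\sup_\sigma R(\rho\rightleftharpoons\sigma)$ over all swap-invariant states $\sigma$ ($V\sigma V=\sigma$); the asymmetry of entanglement is $\mathcal A_E^{as}=1-\mathcal S_E^{as}$. With $\psi_+=\frac1{\sqrt2}(|00\rangle+|11\rangle)$, distillable entanglement is $E_D(\rho)=R(\rho\to\psi_+)$ and entanglement cost is $E_c(\rho)=1/R(\psi_+\to\rho)$; $E_c(\rho)>0$ for every entangled state $\rho$. *)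

(* Defs.v *)
From HB Require Import structures.
From mathcomp Require Import all_boot all_order all_algebra.
From mathcomp Require Import complex.
From mathcomp Require Import all_classical all_reals all_analysis.
Set Implicit Arguments. Unset Printing Implicit Defensive.
Import Order.TTheory GRing.Theory Num.Theory.
Import numFieldNormedType.Exports.
Local Open Scope classical_set_scope.
Local Open Scope ring_scope.

Section Quantum.
Variable R : realType.
Local Notation C := R[i].

(** Matrices with rows indexed by the finite type T and columns by U
    (i.e. linear maps C^U -> C^T in the computational bases). *)
Definition mat (T U : finType) := T -> U -> C.

Definition mulm (T U V : finType) (X : mat T U) (Y : mat U V) : mat T V :=
  fun i k => \sum_(j : U) X i j * Y j k.
Definition adjm (T U : finType) (X : mat T U) : mat U T :=
  fun j i => conjc (X i j).
Definition idm (T : finType) : mat T T := fun i j => (i == j)%:R.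
Definition subm (T U : finType) (X Y : mat T U) : mat T U :=
  fun i j => X i j - Y i j.
Definition trm (T : finType) (X : mat T T) : C := \sum_(i : T) X i i.
Definition kron (T U T' U' : finType) (X : mat T U) (Y : mat T' U')
  : mat (T * T')%type (U * U')%type := fun i j => X i.1 j.1 * Y i.2 j.2.
Definition sandw (T U : finType) (K : mat T U) (X : mat U U) : mat T T :=
  mulm (mulm K X) (adjm K).
Arguments mulm {T U V}.
Arguments adjm {T U}.
Arguments idm  T.
Arguments subm {T U}.
Arguments trm {T}.
Arguments kron {T U T' U'}.
Arguments sandw {T U}.

Definition psd (T : finType) (X : mat T T) : Prop :=
  forall v : T -> C, 0 <= \sum_(i : T) \sum_(j : T) conjc (v i) * X i j * v j.
Definition is_state (T : finType) (X : mat T T) : Prop := psd X /\ trm X = 1.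
Arguments psd {T}.
Arguments is_state {T}.

Definition unitary (T : finType) (U : mat T T) : Prop :=
  mulm (adjm U) U = @idm T.
Arguments unitary {T}.

(** Trace norm, through the variational formula ||X||_1 = sup_U |tr(U X)|
    over unitaries U. *)
Definition tnorm (T : finType) (X : mat T T) : R :=
  sup [set Normc.normc (trm (mulm U X)) | U in [set U | unitary U]].
Arguments tnorm {T}.

Definition tp_kraus (I T U : finType) (K : I -> mat T U) : Prop :=
  forall x y, \sum_(k : I) mulm (adjm (K k)) (K k) x y = @idm U x y.
Arguments tp_kraus {I T U}.

Definition bop (A B : finType) := mat (A * B)%type (A * B)%type.

(** Finite-round LOCC channels from the bipartite system A:B to A':B'.
    - local: a product of local channels (given by Kraus families)
    - Alice (resp. Bob) performs an instrument with outcomes I (each outcome i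
      with Kraus operators K i j, j : J), broadcasts the outcome, and the
      protocol continues with an LOCC channel Psi i depending on i. *)
Inductive LOCC : forall (A B A' B' : finType), (bop A B -> bop A' B') -> Prop :=
| LOCC_local (A B A' B' I J : finType) (K : I -> mat A' A) (L : J -> mat B' B) :
    tp_kraus K -> tp_kraus L ->
    LOCC (fun X => fun x y =>
            \sum_(i : I) \sum_(j : J) sandw (kron (K i) (L j)) X x y)
| LOCC_Alice (A B A'' A' B' I J : finType) (K : I -> J -> mat A'' A)
    (Psi : I -> bop A'' B -> bop A' B') :
    tp_kraus (fun ij : (I * J)%type => K ij.1 ij.2) ->
    (forall i, LOCC (Psi i)) ->
    LOCC (fun X => fun x y =>
            \sum_(i : I) Psi i (fun u v =>
               \sum_(j : J) sandw (kron (K i j) (@idm B)) X u v) x y)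
| LOCC_Bob (A B B'' A' B' I J : finType) (L : I -> J -> mat B'' B)
    (Psi : I -> bop A B'' -> bop A' B') :
    tp_kraus (fun ij : (I * J)%type => L ij.1 ij.2) ->
    (forall i, LOCC (Psi i)) ->
    LOCC (fun X => fun x y =>
            \sum_(i : I) Psi i (fun u v =>
               \sum_(j : J) sandw (kron (@idm A) (L i j)) X u v) x y).

Definition tpow (A B : finType) (rho : bop A B) (n : nat)
  : bop {ffun 'I_n -> A} {ffun 'I_n -> B} :=
  fun x y => \prod_(k < n) rho (x.1 k, x.2 k) (y.1 k, y.2 k).
Arguments tpow {A B}.

Definition achievable (A B A' B' : finType) (rho : bop A B) (sigma : bop A' B')
  (r : R) : Prop :=
  0 <= r /\
  exists (m : nat -> nat)
    (Lam : forall n, bop {ffun 'I_n -> A} {ffun 'I_n -> B} ->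
                     bop {ffun 'I_(m n) -> A'} {ffun 'I_(m n) -> B'}),
    (forall n, LOCC (Lam n)) /\
    ((fun n => (m n)%:R / n%:R : R) @ \oo --> r) /\
    ((fun n => tnorm (subm (Lam n (tpow rho n)) (tpow sigma (m n)))) @ \oo
       --> (0 : R)).
Arguments achievable {A B A' B'}.

Definition rate (A B A' B' : finType) (rho : bop A B) (sigma : bop A' B')
  : \bar R := ereal_sup [set r%:E | r in achievable rho sigma].
Arguments rate {A B A' B'}.

Definition swapop (A B : finType) (rho : bop A B) : bop B A :=
  fun x y => rho (x.2, x.1) (y.2, y.1).
Arguments swapop {A B}.

Definition psi_plus : bop 'I_2 'I_2 :=
  fun x y => if (x.1 == x.2) && (y.1 == y.2) then 2^-1 else 0.
Arguments psi_plus .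

Definition E_D (A B : finType) (rho : bop A B) : \bar R := rate rho psi_plus.
Definition E_c (A B : finType) (rho : bop A B) : \bar R :=
  ((rate psi_plus rho)^-1)%E.
Definition E_b (A B : finType) (rho : bop A B) : \bar R :=
  (E_c rho - E_D rho)%E.
Definition sym_ent (A B : finType) (rho : bop A B) : \bar R :=
  rate rho (swapop rho).
Definition asym_ent (A B : finType) (rho : bop A B) : \bar R :=
  (1 - sym_ent rho)%E.
Arguments E_D {A B}.
Arguments E_c {A B}.
Arguments E_b {A B}.
Arguments sym_ent {A B}.
Arguments asym_ent {A B}.

Definition separable (A B : finType) (rho : bop A B) : Prop :=
  exists (k : nat) (p : 'I_k -> R) (alpha : 'I_k -> mat A A)
         (beta : 'I_k -> mat B B),
    (forall i, 0 <= p i) /\ \sum_(i < k) p i = 1 /\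
    (forall i, is_state (alpha i) /\ is_state (beta i)) /\
    forall x y, rho x y = \sum_(i < k) Complex (p i) 0 * kron (alpha i) (beta i) x y.
Arguments separable {A B}.

Definition entangled (A B : finType) (rho : bop A B) : Prop :=
  is_state rho /\ ~ separable rho.
Arguments entangled {A B}.

End Quantum.

Arguments mulm {R T U V}.
Arguments adjm {R T U}.
Arguments idm {R} T.
Arguments subm {R T U}.
Arguments trm {R T}.
Arguments kron {R T U T' U'}.
Arguments sandw {R T U}.
Arguments psd {R T}.
Arguments is_state {R T}.
Arguments unitary {R T}.
Arguments tnorm {R T}.
Arguments tp_kraus {R I T U}.
Arguments tpow {R A B}.
Arguments achievable {R A B A' B'}.
Arguments rate {R A B A' B'}.
Arguments swapop {R A B}.
Arguments psi_plus {R}.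
Arguments E_D {R A B}.
Arguments E_c {R A B}.
Arguments E_b {R A B}.
Arguments sym_ent {R A B}.
Arguments asym_ent {R A B}.
Arguments separable {R A B}.
Arguments entangled {R A B}.

(* Main.v *)
Require Import Defs.
From HB Require Import structures.
From mathcomp Require Import all_boot all_order all_algebra.
From mathcomp Require Import spectral complex.
From mathcomp Require Import all_classical all_reals all_analysis.
From mathcomp Require Import ring lra.

(** Rates multiply along a chain of transformations, and the maximally
    entangled state psi_+ is invariant under the swap. Hence
    R(rho -> psi_+) R(psi_+ -> rho) <= R(rho -> V rho V) and
    R(psi_+ -> rho) R(rho -> V rho V) <= R(psi_+ -> rho), which gives everything
    once 0 < R(psi_+ -> rho) < +oo. Positivity is teleportation.

    Finiteness says that entangled states have positive cost. The outcome
    distribution of an entangled rho under an informationally complete local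
    measurement lies outside the convex hull of those of the product vectors, so
    there is a weight g > 0 on the outcomes whose mean is at most 1 on every
    product vector, while the mean of 1 / g on rho is some a < 1. On m copies
    the test "the product of the weights is at least t ^ m", with 1 < t < 1 / a,
    rejects rho with probability at most (t a) ^ m. A product vector passes with
    probability at most t ^ -m, because measuring one copy of a product vector
    leaves a product vector, so any state obtained from n copies of psi_+ by
    LOCC passes with probability at most 2 ^ n t ^ -m. *)

Set Implicit Arguments.
Unset Strict Implicit.
Unset Printing Implicit Defensive.

Import Order.TTheory GRing.Theory Num.Theory.
Import numFieldNormedType.Exports.
Local Open Scope classical_set_scope.
Local Open Scope ring_scope.
Local Open Scope complex_scope.
Local Notation Re := complex.Re.
Local Notation Im := complex.Im.
Local Notation normc := Normc.normc.

(** * Finite sums *)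

Section FiniteSums.

Lemma sum_pair (V : nmodType) (T U : finType) (F : T * U -> V) :
  \sum_p F p = \sum_i \sum_j F (i, j).
Proof. by rewrite pair_bigA; apply: eq_bigr => -[]. Qed.

Lemma sum_swap (V : nmodType) (T U : finType) (F : T * U -> V) :
  \sum_p F p = \sum_(q : U * T) F (q.2, q.1).
Proof. by rewrite !sum_pair exchange_big. Qed.

Lemma sum_unit (V : nmodType) (F : unit -> V) : \sum_i F i = F tt.
Proof. by rewrite (big_pred1 tt) //; case. Qed.

Lemma sum_delta (V : pzSemiRingType) (T : finType) (x : T) (F : T -> V) :
  \sum_y (x == y)%:R * F y = F x.
Proof.
rewrite (bigD1 x) //= eqxx mul1r big1 ?addr0// => y.
by rewrite eq_sym => /negPf ->; rewrite mul0r.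
Qed.

Lemma sum_delta_diag (V : pzSemiRingType) (T : finType) (F : T * T -> V) :
  \sum_p (p.1 == p.2)%:R * F p = \sum_z F (z, z).
Proof. by rewrite sum_pair; apply: eq_bigr => z _; rewrite sum_delta. Qed.

Lemma natr_eq_pair (V : pzSemiRingType) (T U : eqType) (p q : T * U) :
  (p == q)%:R = (p.1 == q.1)%:R * (p.2 == q.2)%:R :> V.
Proof. by case: p q => [a b] [c d]; rewrite xpair_eqE -natrM mulnb. Qed.

Lemma natr_eq_ffun (V : comPzSemiRingType) (I : finType) (T : eqType)
    (f g : {ffun I -> T}) :
  (f == g)%:R = \prod_k (f k == g k)%:R :> V.
Proof.
have [->|nfg] := eqVneq f g; first by rewrite big1// => k _; rewrite eqxx.
have /existsP[k nk] : [exists k, f k != g k].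
  rewrite -negb_forall; apply: contra nfg => /forallP fg.
  by apply/eqP/ffunP => k; exact/eqP.
by rewrite (bigD1 k) //= (negPf nk) mul0r.
Qed.

Lemma prod_sum_pair (V : comPzSemiRingType) (I A B : finType)
    (F : I -> A * B -> V) :
  \prod_k \sum_p F k p
  = \sum_(x : {ffun I -> A} * {ffun I -> B}) \prod_k F k (x.1 k, x.2 k).
Proof.
under eq_bigr do rewrite sum_pair.
rewrite bigA_distr_bigA sum_pair /=; apply: eq_bigr => f _.
by rewrite bigA_distr_bigA.
Qed.

Lemma sqr_sum_le (V : realFieldType) (I : finType) (F : I -> V) :
  (\sum_i F i) ^+ 2 <= #|I|%:R * \sum_i F i ^+ 2.
Proof.
have amgm i j : F i * F j <= (F i ^+ 2 + F j ^+ 2) / 2.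
  by have := sqr_ge0 (F i - F j); lra.
rewrite expr2 mulr_suml.
apply: (@le_trans _ _ (\sum_i \sum_j (F i ^+ 2 + F j ^+ 2) / 2)).
  by apply: ler_sum => i _; rewrite mulr_sumr; apply: ler_sum => j _.
under eq_bigr do rewrite -mulr_suml big_split sumr_const /=.
by rewrite -mulr_suml big_split sumr_const sumrMnl mulr_natl /=; lra.
Qed.

End FiniteSums.

(** * Complex vectors and matrices *)

Section ComplexNumbers.
Variable R : realType.
Local Notation C := R[i].
Implicit Types z : C.

Definition sqmod z : R := Re z ^+ 2 + Im z ^+ 2.

Lemma sqmod_ge0 z : 0 <= sqmod z.
Proof. by rewrite addr_ge0 ?sqr_ge0. Qed.

Lemma mulcJ z : z * conjc z = (sqmod z)%:C.
Proof. by rewrite add_Re2_Im2 sqr_normc. Qed.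

Lemma mulJc z : conjc z * z = (sqmod z)%:C.
Proof. by rewrite mulrC mulcJ. Qed.

Lemma sqmodM z z' : sqmod (z * z') = sqmod z * sqmod z'.
Proof. by apply: complexI; rewrite rmorphM/= -!mulcJ rmorphM /=; ring. Qed.

Lemma sqmodJ z : sqmod (conjc z) = sqmod z.
Proof. by apply: complexI; rewrite -!mulcJ conjcK mulrC. Qed.

Lemma sqmod_real (x : R) : sqmod x%:C = x ^+ 2.
Proof. by rewrite /sqmod /= expr0n addr0. Qed.

Lemma sqmod_nat n : sqmod n%:R = n%:R ^+ 2.
Proof. by rewrite -sqmod_real rmorph_nat. Qed.

Lemma sqmod_eq0 z : (sqmod z == 0) = (z == 0).
Proof. by rewrite -(inj_eq (@complexI R)) -mulcJ mulf_eq0 conjc_eq0 orbb. Qed.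

Lemma sqr_normcE z : normc z ^+ 2 = sqmod z.
Proof. by case: z => a b; rewrite sqr_sqrtr// addr_ge0 ?sqr_ge0. Qed.

Lemma normc_ge0 z : 0 <= normc z.
Proof. by case: z => a b; exact: sqrtr_ge0. Qed.

Lemma normc_real (x : R) : normc x%:C = `|x|.
Proof. by rewrite /normc/= expr0n addr0 sqrtr_sqr. Qed.

Lemma normc_sum (I : Type) (s : seq I) (P : pred I) (F : I -> C) :
  normc (\sum_(i <- s | P i) F i) <= \sum_(i <- s | P i) normc (F i).
Proof. exact: (@ler_norm_sum _ (Rcomplex R)). Qed.

Lemma Re_le_normc z : `|Re z| <= normc z.
Proof. by rewrite -lecR -[(normc z)%:C]/(`|z|) normc_ge_Re. Qed.

Lemma sqmod_sum_le (I : finType) (F : I -> C) :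
  sqmod (\sum_i F i) <= #|I|%:R * \sum_i sqmod (F i).
Proof.
by rewrite /sqmod !raddf_sum big_split mulrDr lerD ?sqr_sum_le.
Qed.

End ComplexNumbers.

Section Matrices.
Variable R : realType.
Local Notation C := R[i].
Local Notation mat := (mat R).

Lemma matP (T U : finType) (X Y : mat T U) :
  (forall i j, X i j = Y i j) -> X = Y.
Proof. by move=> XY; apply/funext => i; apply/funext => j. Qed.

Lemma mat_sumE (T U : finType) (I : Type) (s : seq I) (P : pred I)
    (X : I -> mat T U) i j :
  (\sum_(k <- s | P k) X k) i j = \sum_(k <- s | P k) X k i j.
Proof. by rewrite !fct_sumE. Qed.

Lemma submE (T U : finType) (X Y : mat T U) : subm X Y = X - Y.
Proof. by []. Qed.

Definition basisv (T : finType) (i : T) : T -> C := fun j => (i == j)%:R.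

Definition scalev (T : finType) (c : C) (w : T -> C) : T -> C :=
  fun i => c * w i.

Definition kronv (A B : finType) (a : A -> C) (b : B -> C) : A * B -> C :=
  fun p => a p.1 * b p.2.

Definition vdot (T : finType) (a b : T -> C) : C := \sum_i conjc (a i) * b i.

Definition sqnorm (T : finType) (w : T -> C) : R := \sum_i sqmod (w i).

Definition appm (T U : finType) (K : mat T U) (w : U -> C) : T -> C :=
  fun x => \sum_i K x i * w i.

Definition outer (T U : finType) (a : T -> C) (b : U -> C) : mat T U :=
  fun i j => a i * conjc (b j).

Definition qform (T : finType) (X : mat T T) (w : T -> C) : C :=
  vdot w (appm X w).

Definition hermitian (T : finType) (X : mat T T) : Prop := adjm X = X.

Lemma vdot_conj (T : finType) (a b : T -> C) : conjc (vdot a b) = vdot b a.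
Proof.
by rewrite rmorph_sum; apply: eq_bigr => i _; rewrite rmorphM/= conjcK mulrC.
Qed.

Lemma sqmod_vdotC (T : finType) (a b : T -> C) :
  sqmod (vdot a b) = sqmod (vdot b a).
Proof. by rewrite -vdot_conj sqmodJ. Qed.

Lemma vdotvv (T : finType) (w : T -> C) : vdot w w = (sqnorm w)%:C.
Proof. by rewrite rmorph_sum; apply: eq_bigr => i _; rewrite mulJc. Qed.

Lemma sqnorm_ge0 (T : finType) (w : T -> C) : 0 <= sqnorm w.
Proof. by rewrite sumr_ge0// => i _; rewrite sqmod_ge0. Qed.

Lemma vdotDr (T : finType) (a b b' : T -> C) :
  vdot a (b + b') = vdot a b + vdot a b'.
Proof. by rewrite -big_split; apply: eq_bigr => i _; rewrite mulrDr. Qed.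

Lemma vdotDl (T : finType) (a a' b : T -> C) :
  vdot (a + a') b = vdot a b + vdot a' b.
Proof. by rewrite -vdot_conj vdotDr rmorphD/= !vdot_conj. Qed.

Lemma vdotZr (T : finType) c (a b : T -> C) :
  vdot a (scalev c b) = c * vdot a b.
Proof. by rewrite mulr_sumr; apply: eq_bigr => i _; rewrite mulrCA. Qed.

Lemma vdotZl (T : finType) c (a b : T -> C) :
  vdot (scalev c a) b = conjc c * vdot a b.
Proof. by rewrite -vdot_conj vdotZr rmorphM/= vdot_conj. Qed.

Lemma vdot_sumr (T : finType) (I : Type) (s : seq I) a (b : I -> T -> C) :
  vdot a (\sum_(k <- s) b k) = \sum_(k <- s) vdot a (b k).
Proof.
rewrite /vdot [RHS]exchange_big; apply: eq_bigr => i _.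
by rewrite fct_sumE mulr_sumr.
Qed.

Lemma sqnormZ (T : finType) c (w : T -> C) :
  sqnorm (scalev c w) = sqmod c * sqnorm w.
Proof. by rewrite mulr_sumr; apply: eq_bigr => i _; rewrite sqmodM. Qed.

Lemma vdot_basisl (T : finType) (t : T) w : vdot (basisv t) w = w t.
Proof. by under [LHS]eq_bigr do rewrite conjc_nat; rewrite sum_delta. Qed.

Lemma vdot_basis (T : finType) (s t : T) :
  vdot (basisv s) (basisv t) = (s == t)%:R.
Proof. by rewrite vdot_basisl /basisv eq_sym. Qed.

Lemma sqnorm_basis (T : finType) (t : T) : sqnorm (basisv t) = 1.
Proof. by apply: complexI; rewrite -vdotvv vdot_basis eqxx. Qed.

Lemma vdot_kronv (A B : finType) (a a' : A -> C) (b b' : B -> C) :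
  vdot (kronv a b) (kronv a' b') = vdot a a' * vdot b b'.
Proof.
rewrite {1}/vdot sum_pair mulr_suml; apply: eq_bigr => i _; rewrite mulr_sumr.
by apply: eq_bigr => j _; rewrite rmorphM/= mulrACA.
Qed.

Lemma sqnorm_kronv (A B : finType) (a : A -> C) (b : B -> C) :
  sqnorm (kronv a b) = sqnorm a * sqnorm b.
Proof. by apply: complexI; rewrite rmorphM/= -!vdotvv vdot_kronv. Qed.

Lemma normc_vdot_le (T : finType) (a b : T -> C) :
  normc (vdot a b) <= (sqnorm a + sqnorm b) / 2.
Proof.
rewrite (le_trans (normc_sum _ _ _))// -big_split mulr_suml ler_sum// => i _ /=.
rewrite Normc.normcM -(sqmodJ (a i)) -!sqr_normcE.
have := sqr_ge0 (normc (conjc (a i)) - normc (b i)); lra.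
Qed.

Lemma mulmA (T U V W : finType) (X : mat T U) (Y : mat U V) (Z : mat V W) :
  mulm X (mulm Y Z) = mulm (mulm X Y) Z.
Proof.
apply: matP => x y; rewrite /mulm; under eq_bigr do rewrite mulr_sumr.
rewrite exchange_big; apply: eq_bigr => j _; rewrite mulr_suml.
by apply: eq_bigr => i _; rewrite mulrA.
Qed.

Lemma mulm1 (T U : finType) (K : mat T U) : mulm K (idm U) = K.
Proof.
apply: matP => x y; rewrite /mulm -[RHS](sum_delta y (K x)).
by apply: eq_bigr => i _; rewrite /idm mulrC eq_sym.
Qed.

Lemma mul1m (T U : finType) (K : mat T U) : mulm (idm T) K = K.
Proof. by apply: matP => x y; rewrite /mulm /idm sum_delta. Qed.

Lemma adjmK (T U : finType) (K : mat T U) : adjm (adjm K) = K.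
Proof. by apply: matP => i j; rewrite /adjm conjcK. Qed.

Lemma adjm_mulm (T U V : finType) (K : mat T U) (L : mat U V) :
  adjm (mulm K L) = mulm (adjm L) (adjm K).
Proof.
apply: matP => x y; rewrite /mulm /adjm rmorph_sum.
by apply: eq_bigr => i _; rewrite rmorphM mulrC.
Qed.

Lemma adjm_idm (T : finType) : adjm (idm T) = idm T :> mat T T.
Proof. by apply: matP => i j; rewrite /adjm /idm conjc_nat eq_sym. Qed.

Lemma mulmBr (T U V : finType) (K : mat T U) (X Y : mat U V) :
  mulm K (X - Y) = mulm K X - mulm K Y.
Proof.
apply: matP => i j; rewrite -[RHS]/(mulm K X i j - mulm K Y i j) /mulm -sumrB.
by apply: eq_bigr => k _; rewrite -mulrBr.
Qed.

HB.instance Definition _ (T U V : finType) (K : mat T U) :=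
  GRing.isZmodMorphism.Build (mat U V) (mat T V) (mulm K) (mulmBr K).

Lemma adjmB (T U : finType) (X Y : mat T U) : adjm (X - Y) = adjm X - adjm Y.
Proof. by apply: matP => i j; exact: rmorphB. Qed.

HB.instance Definition _ (T U : finType) :=
  GRing.isZmodMorphism.Build (mat T U) (mat U T) adjm (@adjmB T U).

Lemma sandw_adjmE (T U : finType) (K : mat T U) (X : mat U U) :
  sandw K X = mulm K (adjm (mulm K (adjm X))).
Proof. by rewrite /sandw adjm_mulm adjmK mulmA. Qed.

Lemma sandwB (T U : finType) (K : mat T U) (X Y : mat U U) :
  sandw K (X - Y) = sandw K X - sandw K Y.
Proof. by rewrite !sandw_adjmE adjmB mulmBr adjmB mulmBr. Qed.

HB.instance Definition _ (T U : finType) (K : mat T U) :=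
  GRing.isZmodMorphism.Build (mat U U) (mat T T) (sandw K) (sandwB K).

Lemma mulm_suml (T U V : finType) (L : mat U V) (I : Type) (s : seq I)
    (P : pred I) (X : I -> mat T U) :
  mulm (\sum_(k <- s | P k) X k) L = \sum_(k <- s | P k) mulm (X k) L.
Proof.
rewrite -[LHS]adjmK adjm_mulm !raddf_sum.
by apply: eq_bigr => k _; rewrite /= adjm_mulm !adjmK.
Qed.

Lemma mulmBl (T U V : finType) (L : mat U V) (X Y : mat T U) :
  mulm (X - Y) L = mulm X L - mulm Y L.
Proof.
by rewrite -[LHS]adjmK adjm_mulm adjmB mulmBr adjmB !adjm_mulm !adjmK.
Qed.

Lemma mul0m (T U V : finType) (L : mat U V) : mulm 0 L = 0 :> mat T V.
Proof. by rewrite -(subrr 0) mulmBl subrr. Qed.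

Lemma adjm_kron (T U T' U' : finType) (K : mat T U) (K' : mat T' U') :
  adjm (kron K K') = kron (adjm K) (adjm K').
Proof. by apply: matP => i j; exact: rmorphM. Qed.

Lemma mulm_kron (T U V T' U' V' : finType) (K : mat T U) (L : mat U V)
    (K' : mat T' U') (L' : mat U' V') :
  mulm (kron K K') (kron L L') = kron (mulm K L) (mulm K' L').
Proof.
apply: matP => x y; rewrite /mulm /kron sum_pair mulr_suml.
apply: eq_bigr => i _; rewrite mulr_sumr.
by apply: eq_bigr => j _; rewrite mulrACA.
Qed.

Lemma kron_idm (T U : finType) :
  kron (idm T) (idm U) = idm (T * U)%type :> mat _ _.
Proof. by apply: matP => i j; rewrite /idm natr_eq_pair. Qed.

Lemma kron_sum (T U T' U' : finType) (I J : Type) (s : seq I) (t : seq J)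
    (K : I -> mat T U) (L : J -> mat T' U') :
  kron (\sum_(i <- s) K i) (\sum_(j <- t) L j)
  = \sum_(i <- s) \sum_(j <- t) kron (K i) (L j).
Proof.
apply: matP => x y; rewrite /kron !mat_sumE mulr_suml; apply: eq_bigr => i _.
by rewrite mat_sumE mulr_sumr.
Qed.

Lemma sandw_mulm (T U V : finType) (K : mat T U) (L : mat U V) X :
  sandw (mulm K L) X = sandw K (sandw L X).
Proof. by rewrite /sandw adjm_mulm !mulmA. Qed.

Lemma sandw_idm (T : finType) (X : mat T T) : sandw (idm T) X = X.
Proof. by rewrite /sandw adjm_idm mul1m mulm1. Qed.

Lemma adjm_sandw (T U : finType) (K : mat T U) (X : mat U U) :
  adjm (sandw K X) = sandw K (adjm X).
Proof. by rewrite sandw_adjmE adjm_mulm adjmK /sandw. Qed.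

Lemma hermitianB (T : finType) (X Y : mat T T) :
  hermitian X -> hermitian Y -> hermitian (X - Y).
Proof. by rewrite /hermitian adjmB => -> ->. Qed.

Lemma trmB (T : finType) (X Y : mat T T) : trm (X - Y) = trm X - trm Y.
Proof. by rewrite /trm -sumrB. Qed.

HB.instance Definition _ (T : finType) :=
  GRing.isZmodMorphism.Build (mat T T) C trm (@trmB T).

Lemma trm_mulmC (T U : finType) (X : mat T U) (Y : mat U T) :
  trm (mulm X Y) = trm (mulm Y X).
Proof.
by rewrite /trm exchange_big; do 2 apply: eq_bigr => ? _; rewrite mulrC.
Qed.

Lemma trm_mulm_sandw (T U : finType) (M : mat T T) (K : mat T U) (X : mat U U) :
  trm (mulm M (sandw K X)) = trm (mulm (sandw (adjm K) M) X).
Proof.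
by rewrite /sandw adjmK trm_mulmC -!mulmA trm_mulmC -!mulmA trm_mulmC -!mulmA.
Qed.

Lemma trm1_inhabited (T : finType) (X : mat T T) : trm X = 1 -> inhabited T.
Proof.
move=> X1; case: (pickP (xpredT : pred T)) => [t _|T0]; first by exists.
by move: X1; rewrite /trm big_pred0// => /esym/eqP; rewrite oner_eq0.
Qed.

Lemma appm_mulm (T U V : finType) (K : mat T U) (L : mat U V) w :
  appm (mulm K L) w = appm K (appm L w).
Proof.
apply/funext => x; rewrite /appm /mulm; under eq_bigr do rewrite mulr_suml.
rewrite exchange_big; apply: eq_bigr => j _; rewrite mulr_sumr.
by apply: eq_bigr => i _; rewrite mulrA.
Qed.

Lemma appm_idm (T : finType) (w : T -> C) : appm (idm T) w = w.
Proof. by apply/funext => x; rewrite /appm /idm sum_delta. Qed.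

Lemma appm_kron (T U T' U' : finType) (K : mat T U) (L : mat T' U') a b :
  appm (kron K L) (kronv a b) = kronv (appm K a) (appm L b).
Proof.
apply/funext => x; rewrite /appm /kronv sum_pair mulr_suml.
by apply: eq_bigr => i _; rewrite mulr_sumr; apply: eq_bigr => j _;
  rewrite mulrACA.
Qed.

Lemma appm_basis (T U : finType) (K : mat T U) t : appm K (basisv t) = K^~ t.
Proof.
apply/funext => x; rewrite /appm -[RHS](sum_delta t (K x)).
by apply: eq_bigr => i _; rewrite mulrC.
Qed.

Lemma kronv_basis (T U : finType) (t : T) (u : U) :
  kronv (basisv t) (basisv u) = basisv (t, u).
Proof. by apply/funext => p; rewrite /basisv natr_eq_pair. Qed.

Lemma appmD (T U : finType) (K : mat T U) (a b : U -> C) :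
  appm K (a + b) = appm K a + appm K b.
Proof.
apply/funext => x; rewrite -[RHS]/(appm K a x + appm K b x) -big_split.
by apply: eq_bigr => i _; rewrite mulrDr.
Qed.

Lemma appmZ (T U : finType) (K : mat T U) c (w : U -> C) :
  appm K (scalev c w) = scalev c (appm K w).
Proof.
by apply/funext => x; rewrite /scalev mulr_sumr; apply: eq_bigr => i _;
  rewrite mulrCA.
Qed.

Lemma vdot_appm (T U : finType) (K : mat T U) a b :
  vdot a (appm K b) = vdot (appm (adjm K) a) b.
Proof.
rewrite /vdot; under eq_bigr do rewrite mulr_sumr.
rewrite exchange_big; apply: eq_bigr => i _; rewrite rmorph_sum mulr_suml.
by apply: eq_bigr => j _; rewrite rmorphM /= conjcK mulrCA mulrA.
Qed.

Lemma vdot_appm_basis (T U : finType) (K : mat T U) t u :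
  vdot (basisv t) (appm K (basisv u)) = K t u.
Proof. by rewrite vdot_basisl appm_basis. Qed.

Lemma adjm_outer (T U : finType) (a : T -> C) (b : U -> C) :
  adjm (outer a b) = outer b a.
Proof. by apply: matP => i j; rewrite /adjm /outer rmorphM /= conjcK mulrC. Qed.

Lemma mulm_outer (T U V : finType) (K : mat T U) (a : U -> C) (b : V -> C) :
  mulm K (outer a b) = outer (appm K a) b.
Proof.
by apply: matP => i j; rewrite /outer mulr_suml; apply: eq_bigr => k _;
  rewrite mulrA.
Qed.

Lemma appm_outer (T U : finType) (a : T -> C) (b w : U -> C) :
  appm (outer a b) w = scalev (vdot b w) a.
Proof.
apply/funext => x; rewrite /appm /scalev mulr_suml.
by apply: eq_bigr => i _; rewrite /outer mulrAC mulrC mulrA mulrAC.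
Qed.

Lemma sandw_outer (T U : finType) (K : mat T U) a :
  sandw K (outer a a) = outer (appm K a) (appm K a).
Proof.
by rewrite /sandw mulm_outer -[LHS]adjmK adjm_mulm adjmK adjm_outer mulm_outer
  adjm_outer.
Qed.

Lemma kron_outer (T U T' U' : finType) (a : T -> C) (b : U -> C) (a' : T' -> C)
    (b' : U' -> C) :
  kron (outer a b) (outer a' b') = outer (kronv a a') (kronv b b').
Proof. by apply: matP => i j; rewrite /kron /outer /kronv rmorphM mulrACA. Qed.

Lemma trm_outer (T : finType) (a b : T -> C) : trm (outer a b) = vdot b a.
Proof. by apply: eq_bigr => i _; rewrite mulrC. Qed.

Lemma qformE (T : finType) (X : mat T T) w :
  qform X w = \sum_i \sum_j conjc (w i) * X i j * w j.
Proof.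
apply: eq_bigr => i _; rewrite mulr_sumr.
by apply: eq_bigr => j _; rewrite mulrA.
Qed.

Lemma psdP (T : finType) (X : mat T T) : psd X <-> forall w, 0 <= qform X w.
Proof. by split=> psdX w; have := psdX w; rewrite qformE. Qed.

Lemma qform_trm (T : finType) (X : mat T T) w :
  qform X w = trm (mulm (outer w w) X).
Proof. by rewrite trm_mulmC mulm_outer trm_outer. Qed.

Lemma qform_sum (T : finType) (I : Type) (s : seq I) (P : pred I)
    (X : I -> mat T T) w :
  qform (\sum_(k <- s | P k) X k) w = \sum_(k <- s | P k) qform (X k) w.
Proof.
by rewrite qform_trm !raddf_sum; under [RHS]eq_bigr do rewrite qform_trm.
Qed.

Lemma qformB (T : finType) (X Y : mat T T) w :
  qform (X - Y) w = qform X w - qform Y w.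
Proof. by rewrite !qform_trm mulmBr trmB. Qed.

Lemma qform_idm (T : finType) (w : T -> C) : qform (idm T) w = (sqnorm w)%:C.
Proof. by rewrite /qform appm_idm vdotvv. Qed.

Lemma qform_adjm (T : finType) (X : mat T T) w :
  qform (adjm X) w = conjc (qform X w).
Proof. by rewrite /qform vdot_conj vdot_appm adjmK. Qed.

Lemma qformZ (T : finType) (X : mat T T) c w :
  qform X (scalev c w) = (sqmod c)%:C * qform X w.
Proof. by rewrite /qform appmZ vdotZr vdotZl mulrA mulcJ. Qed.

Lemma qform_sandw (T U : finType) (K : mat T U) (X : mat U U) w :
  qform (sandw K X) w = qform X (appm (adjm K) w).
Proof. by rewrite /qform /sandw !appm_mulm vdot_appm. Qed.

Lemma sandw_outerl (T U : finType) (u : T -> C) (v : U -> C) (X : mat U U) :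
  sandw (outer u v) X = outer (scalev (qform X v) u) u.
Proof.
rewrite /sandw adjm_outer mulm_outer -appm_outer appm_mulm !appm_outer /qform.
by rewrite vdot_appm.
Qed.

Lemma qform_outer (T : finType) (a w : T -> C) :
  qform (outer a a) w = (sqmod (vdot a w))%:C.
Proof. by rewrite /qform appm_outer vdotZr -mulcJ vdot_conj. Qed.

Lemma sqnorm_appm (T U : finType) (K : mat T U) w :
  (sqnorm (appm K w))%:C = qform (mulm (adjm K) K) w.
Proof. by rewrite /qform appm_mulm vdot_appm adjmK vdotvv. Qed.

Lemma sum_sqnorm_appm (T U : finType) (I : Type) (s : seq I)
    (K : I -> mat T U) w :
  \sum_(k <- s) mulm (adjm (K k)) (K k) = idm U ->
  \sum_(k <- s) sqnorm (appm (K k) w) = sqnorm w.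
Proof.
move=> tpK; apply: complexI; rewrite -qform_idm -tpK qform_sum rmorph_sum.
by apply: eq_bigr => k _; rewrite /= sqnorm_appm.
Qed.

End Matrices.

Arguments basisv {R T}.

(** * Polarisation *)

Section Polarisation.
Variable R : realType.
Local Notation C := R[i].
Local Notation mat := (mat R).

Lemma conjc_iX n : conjc ('i ^+ n) = (- 'i) ^+ n :> C.
Proof. by rewrite rmorphXn; congr (_ ^+ n); congr Complex; rewrite oppr0. Qed.

Lemma qformD (T : finType) (X : mat T T) a b :
  qform X (a + b)
  = qform X a + vdot a (appm X b) + vdot b (appm X a) + qform X b.
Proof. by rewrite /qform appmD !vdotDr !vdotDl; ring. Qed.

Lemma qform_polarisation (T : finType) (X : mat T T) a b :
  \sum_(s < 4) 'i ^+ s * qform X (a + scalev ('i ^+ s) b)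
    = 4 * vdot b (appm X a).
Proof.
have i_sqr : 'i * 'i = -1 :> C by rewrite -expr2 sqr_i.
under eq_bigr => s _ do
  rewrite qformD qformZ -mulJc appmZ vdotZr vdotZl conjc_iX.
rewrite !big_ord_recr big_ord0 /= !(exprS, expr0) !mulr1.
by move: ('i : C) i_sqr => i i_sqr; ring: i_sqr.
Qed.

Lemma qform_basis_phase_eq0 (T : finType) (X : mat T T) :
  (forall p q (s : 'I_4),
    qform X (basisv p + scalev ('i ^+ s) (basisv q)) = 0) -> X = 0.
Proof.
move=> X0; apply: matP => q p; apply/eqP.
have := qform_polarisation X (basisv p) (basisv q).
rewrite vdot_appm_basis big1 => [/esym/eqP|s _]; last by rewrite X0 mulr0.
by rewrite mulf_eq0 pnatr_eq0.
Qed.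

Lemma qform_inj (T : finType) (X Y : mat T T) :
  (forall w, qform X w = qform Y w) -> X = Y.
Proof.
move=> XY; apply/eqP; rewrite -subr_eq0; apply/eqP.
by apply: qform_basis_phase_eq0 => p q s; rewrite qformB XY subrr.
Qed.

Lemma psd_hermitian (T : finType) (X : mat T T) : psd X -> hermitian X.
Proof.
move=> /psdP psdX; apply: qform_inj => w.
by rewrite qform_adjm -(RRe_real (ger0_real (psdX w))) conjc_real.
Qed.

Lemma psd_qform_real (T : finType) (X : mat T T) w :
  psd X -> qform X w = (Re (qform X w))%:C.
Proof. by move=> /psdP psdX; rewrite RRe_real// ger0_real. Qed.

Lemma psd_sandw (T U : finType) (K : mat T U) (X : mat U U) :
  psd X -> psd (sandw K X).
Proof. by move=> /psdP psdX; apply/psdP => w; rewrite qform_sandw. Qed.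

Lemma psd_outer (T : finType) (a : T -> C) : psd (outer a a).
Proof. by apply/psdP => w; rewrite qform_outer ler0c sqmod_ge0. Qed.

Lemma is_state_outer (T : finType) (a : T -> C) :
  sqnorm a = 1 -> is_state (outer a a).
Proof. by move=> a1; split; [exact: psd_outer|rewrite trm_outer vdotvv a1]. Qed.

Lemma state_hermitian (T : finType) (X : mat T T) : is_state X -> hermitian X.
Proof. by case=> /psd_hermitian. Qed.

End Polarisation.

(** * The spectral theorem *)

Section SpectralTheorem.
Variable R : realType.
Local Notation C := R[i].
Local Notation mat := (mat R).

Definition of_mx (T U : finType) (M : 'M[C]_(#|T|, #|U|)) : mat T U :=
  fun i j => M (enum_rank i) (enum_rank j).

Lemma of_mx_surj (T U : finType) (X : mat T U) : exists M, X = of_mx M.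
Proof.
exists (\matrix_(i, j) X (enum_val i) (enum_val j)).
by apply: matP => i j; rewrite /of_mx mxE !enum_rankK.
Qed.

Lemma of_mx_inj (T U : finType) : injective (@of_mx T U).
Proof.
move=> M N MN; apply/matrixP => i j.
by have := congr1 (fun X : mat T U => X (enum_val i) (enum_val j)) MN;
  rewrite /of_mx !enum_valK.
Qed.

Lemma of_mx_mul (T U V : finType) (M : 'M[C]_(#|T|, #|U|))
    (N : 'M[C]_(#|U|, #|V|)) :
  of_mx (M *m N) = mulm (of_mx M) (of_mx N) :> mat T V.
Proof.
apply: matP => i j; rewrite /of_mx /mulm mxE (reindex (@enum_rank U))//.
exact: onW_bij (enum_rank_bij U).
Qed.

Lemma of_mx1 (T : finType) : of_mx 1%:M = idm T :> mat T T.
Proof. by apply: matP => i j; rewrite /of_mx mxE (inj_eq enum_rank_inj). Qed.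

Lemma of_mx_adj (T U : finType) (M : 'M[C]_(#|T|, #|U|)) :
  of_mx (map_mx Num.conj M^T) = adjm (of_mx M).
Proof. by apply: matP => i j; rewrite /of_mx !mxE. Qed.

Lemma mulm1C (T : finType) (X Y : mat T T) :
  mulm X Y = idm T -> mulm Y X = idm T.
Proof.
have [M ->] := of_mx_surj X; have [N ->] := of_mx_surj Y.
by rewrite -!of_mx_mul -of_mx1 => /of_mx_inj/mulmx1C ->.
Qed.

Lemma unitary_idm (T : finType) : unitary (@idm R T).
Proof. by rewrite /unitary adjm_idm mulm1. Qed.

Definition diagm (T : finType) (d : T -> R) : mat T T :=
  fun i j => (i == j)%:R * (d i)%:C.

Lemma adjm_diagm (T : finType) (d : T -> R) : adjm (diagm d) = diagm d.
Proof.
apply: matP => i j; rewrite /adjm /diagm rmorphM /= conjc_nat oppr0 eq_sym.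
by case: eqP => [->//|_]; rewrite !mul0r.
Qed.

Lemma mulm_diagm (T : finType) (d e : T -> R) :
  mulm (diagm d) (diagm e) = diagm (fun i => d i * e i).
Proof.
apply: matP => i j; rewrite /mulm /diagm; under eq_bigr do rewrite -mulrA.
by rewrite sum_delta rmorphM mulrCA.
Qed.

Lemma trm_mulm_diagm (T : finType) (M : mat T T) (d : T -> R) :
  trm (mulm M (diagm d)) = \sum_k (d k)%:C * M k k.
Proof.
apply: eq_bigr => i _; rewrite -[RHS](sum_delta i (fun k => (d k)%:C * M i k)).
by apply: eq_bigr => k _; rewrite /diagm [k == i]eq_sym mulrCA [M i k * _]mulrC.
Qed.

Lemma diagm_sum_outer (T : finType) (d : T -> R) : (forall k, 0 <= d k) ->
  diagm d = \sum_k let a := scalev (Num.sqrt (d k))%:C (basisv k) in outer a a.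
Proof.
move=> d_ge0; apply: matP => i j; rewrite mat_sumE.
rewrite -[LHS](sum_delta i (fun k => (k == j)%:R * (d k)%:C)).
apply: eq_bigr => k _.
rewrite /outer /scalev /basisv rmorphM /= conjc_nat oppr0 mulrACA
  [k == i]eq_sym.
by rewrite -rmorphM -expr2 sqr_sqrtr//; ring.
Qed.

Theorem spectral_decomposition (T : finType) (X : mat T T) : hermitian X ->
  exists (W : mat T T) (d : T -> R), unitary W /\ X = sandw W (diagm d).
Proof.
have [A ->] := of_mx_surj X => hermX.
have hermA : A \is hermsymmx.
  by apply/is_hermitianmxP; rewrite expr0 scale1r; apply: of_mx_inj;
    rewrite of_mx_adj hermX.
have /orthomx_spectralP := hermitian_normalmx hermA.
have unitaryP := spectral_unitarymx A; rewrite invmx_unitary//.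
move: (hermitian_spectral_diag_real hermA) (unitarymxP unitaryP).
set P := spectralmx A; set D := spectral_diag A => /mxOverP D_real mulP_adj ->.
exists (of_mx (map_mx Num.conj P^T)), (fun k => Re (D 0 (enum_rank k))); split.
  by rewrite /unitary -of_mx_adj -of_mx_mul map_trmx trmxK map_mxCK mulP_adj
    of_mx1.
have DE : diagm (fun k => Re (D 0 (enum_rank k))) = of_mx (diag_mx D).
  apply: matP => i j; rewrite /diagm /of_mx mxE (inj_eq enum_rank_inj).
  by rewrite RRe_real ?D_real// mulr_natl.
by rewrite /sandw DE -of_mx_adj -!of_mx_mul map_trmx trmxK map_mxCK.
Qed.

Lemma psd_sum_outer (T : finType) (X : mat T T) : psd X ->
  exists phi : T -> T -> C, X = \sum_k outer (phi k) (phi k).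
Proof.
move=> psdX.
have [W [d [unitaryW XE]]] := spectral_decomposition (psd_hermitian psdX).
have d_ge0 k : 0 <= d k.
  have /psdP/(_ (basisv k)) := psd_sandw (adjm W) psdX.
  rewrite XE -sandw_mulm unitaryW sandw_idm /qform vdot_appm_basis.
  by rewrite /diagm eqxx mul1r ler0c.
exists (fun k => appm W (scalev (Num.sqrt (d k))%:C (basisv k))).
by rewrite XE diagm_sum_outer// raddf_sum;
  under eq_bigr do rewrite /= sandw_outer.
Qed.

End SpectralTheorem.

(** * The trace norm of Hermitian matrices *)

Section TraceNorm.
Variable R : realType.
Local Notation mat := (mat R).

(* Numerical radius at most one: this is all the trace norm duality needs,
   and unlike unitarity it passes to the adjoint of a channel. *)
Definition num_contraction (T : finType) (M : mat T T) :=
  forall w, normc (qform M w) <= sqnorm w.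

Lemma unitary_num_contraction (T : finType) (U : mat T T) :
  unitary U -> num_contraction U.
Proof.
move=> unitaryU w; have Uw : sqnorm (appm U w) = sqnorm w.
  by apply: complexI; rewrite sqnorm_appm unitaryU qform_idm.
by rewrite (le_trans (normc_vdot_le _ _))// Uw; lra.
Qed.

Section Diagonalised.
Variables (T : finType) (W : mat T T) (d : T -> R).
Hypothesis unitaryW : unitary W.

Lemma normc_trm_mulm_diagonalised_le M : num_contraction M ->
  normc (trm (mulm M (sandw W (diagm d)))) <= \sum_k `|d k|.
Proof.
move=> contrM.
rewrite trm_mulm_sandw trm_mulm_diagm (le_trans (normc_sum _ _ _))//.
apply: ler_sum => k _; rewrite Normc.normcM normc_real ler_piMr//.
rewrite -vdot_appm_basis -/(qform _ _) qform_sandw adjmK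
  (le_trans (contrM _))//.
rewrite -lecR sqnorm_appm unitaryW qform_idm sqnorm_basis lexx //.
Qed.

Lemma exists_unitary_trm_mulm :
  exists2 U, unitary U & trm (mulm U (sandw W (diagm d))) = (\sum_k `|d k|)%:C.
Proof.
pose s k : R := if 0 <= d k then 1 else -1.
have s_sqr k : s k * s k = 1 by rewrite /s; case: ifP => _; ring.
have mul_ds k : d k * s k = `|d k|.
  rewrite /s; case: lerP => [d_ge0|d_lt0]; first by rewrite ger0_norm// mulr1.
  by rewrite ltr0_norm// mulrN1.
exists (sandw W (diagm s)).
  rewrite /unitary adjm_sandw adjm_diagm /sandw !mulmA -(mulmA _ (adjm W) W)
    unitaryW mulm1.
  rewrite -(mulmA W) mulm_diagm; have -> : diagm (fun k => s k * s k) = idm T.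
    by apply: matP => i j; rewrite /diagm s_sqr mulr1.
  by rewrite mulm1; exact: mulm1C.
rewrite trm_mulm_sandw -sandw_mulm unitaryW sandw_idm trm_mulm_diagm rmorph_sum.
by apply: eq_bigr => k _; rewrite /diagm eqxx mul1r -mul_ds rmorphM.
Qed.

Lemma tnorm_diagonalised : tnorm (sandw W (diagm d)) = \sum_k `|d k|.
Proof.
have [U unitaryU UE] := exists_unitary_trm_mulm.
have attained :
    [set normc (trm (mulm V (sandw W (diagm d)))) | V in [set V | unitary V]]
    (\sum_k `|d k|).
  by exists U => //; rewrite UE normc_real ger0_norm// sumr_ge0.
apply/eqP; rewrite eq_le; apply/andP; split.
  apply: ge_sup => [|_ [V unitaryV <-]]; first by exists (\sum_k `|d k|).
  exact/normc_trm_mulm_diagonalised_le/unitary_num_contraction.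
apply: ub_le_sup => //; exists (\sum_k `|d k|) => _ [V unitaryV <-].
exact/normc_trm_mulm_diagonalised_le/unitary_num_contraction.
Qed.

End Diagonalised.

Lemma normc_trm_le_tnorm (T : finType) (X M : mat T T) :
  hermitian X -> num_contraction M -> normc (trm (mulm M X)) <= tnorm X.
Proof.
move=> /spectral_decomposition[W [d [unitaryW ->]]] contrM.
by rewrite tnorm_diagonalised// normc_trm_mulm_diagonalised_le.
Qed.

Lemma tnorm_le (T : finType) (X : mat T T) c :
  (forall M, num_contraction M -> normc (trm (mulm M X)) <= c) -> tnorm X <= c.
Proof.
move=> bound; apply: ge_sup => [|_ [U unitaryU <-]];
  last exact/bound/unitary_num_contraction.
by exists (normc (trm (mulm (idm T) X))), (idm T) => //; exact: unitary_idm.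
Qed.

Lemma tnorm_ge0 (T : finType) (X : mat T T) : hermitian X -> 0 <= tnorm X.
Proof.
move=> /normc_trm_le_tnorm/(_ (unitary_num_contraction (@unitary_idm R T))).
exact/le_trans/normc_ge0.
Qed.

Lemma tnorm0 (T : finType) : tnorm (0 : mat T T) = 0.
Proof.
have herm0 : hermitian (0 : mat T T) by exact: (raddf0 adjm).
apply/eqP; rewrite eq_le tnorm_ge0// andbT; apply: tnorm_le => M _.
by rewrite !raddf0 Normc.normc0.
Qed.

Lemma ler_tnormD (T : finType) (X Y : mat T T) : hermitian X -> hermitian Y ->
  tnorm (X + Y) <= tnorm X + tnorm Y.
Proof.
move=> hermX hermY; apply: tnorm_le => M contrM.
by rewrite !raddfD (le_trans (le_normcD _ _))// lerD// normc_trm_le_tnorm.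
Qed.

End TraceNorm.

(** * LOCC channels *)

Section Protocols.
Variable R : realType.
Local Notation mat := (mat R).
Local Notation bop := (bop R).

Lemma tp_krausP (I T U : finType) (K : I -> mat T U) :
  tp_kraus K <-> \sum_k mulm (adjm (K k)) (K k) = idm U.
Proof.
split=> [tpK|tpK x y]; last by rewrite -tpK mat_sumE.
by apply: matP => x y; rewrite mat_sumE tpK.
Qed.

Definition local_channel (A B A' B' I J : finType) (K : I -> mat A' A)
    (L : J -> mat B' B) :
  bop A B -> bop A' B' := fun X => \sum_i \sum_j sandw (kron (K i) (L j)) X.

Definition Alice_protocol (A B A'' A' B' I J : finType)
    (K : I -> J -> mat A'' A) (Psi : I -> bop A'' B -> bop A' B') :
  bop A B -> bop A' B' :=
  fun X => \sum_i Psi i (\sum_j sandw (kron (K i j) (idm B)) X).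

Definition Bob_protocol (A B B'' A' B' I J : finType) (L : I -> J -> mat B'' B)
    (Psi : I -> bop A B'' -> bop A' B') : bop A B -> bop A' B' :=
  fun X => \sum_i Psi i (\sum_j sandw (kron (idm A) (L i j)) X).

Lemma local_channelE (A B A' B' I J : finType) (K : I -> mat A' A)
    (L : J -> mat B' B) :
  local_channel K L = fun X x y => \sum_i \sum_j sandw (kron (K i) (L j)) X x y.
Proof.
apply/funext => X; apply: matP => x y; rewrite /local_channel mat_sumE.
by apply: eq_bigr => i _; rewrite mat_sumE.
Qed.

Lemma Alice_protocolE (A B A'' A' B' I J : finType) (K : I -> J -> mat A'' A)
    (Psi : I -> bop A'' B -> bop A' B') :
  Alice_protocol K Psi = fun X x y =>
    \sum_i Psi i (fun u v => \sum_j sandw (kron (K i j) (idm B)) X u v) x y.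
Proof.
apply/funext => X; apply: matP => x y; rewrite /Alice_protocol mat_sumE.
apply: eq_bigr => i _.
by congr (Psi i _ x y); apply: matP => u v; rewrite mat_sumE.
Qed.

Lemma Bob_protocolE (A B B'' A' B' I J : finType) (L : I -> J -> mat B'' B)
    (Psi : I -> bop A B'' -> bop A' B') :
  Bob_protocol L Psi = fun X x y =>
    \sum_i Psi i (fun u v => \sum_j sandw (kron (idm A) (L i j)) X u v) x y.
Proof.
apply/funext => X; apply: matP => x y; rewrite /Bob_protocol mat_sumE.
apply: eq_bigr => i _.
by congr (Psi i _ x y); apply: matP => u v; rewrite mat_sumE.
Qed.

Lemma LOCC_local_channel (A B A' B' I J : finType) (K : I -> mat A' A)
    (L : J -> mat B' B) :
  tp_kraus K -> tp_kraus L -> LOCC (local_channel K L).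
Proof. by rewrite local_channelE; exact: LOCC_local. Qed.

Lemma LOCC_Alice_protocol (A B A'' A' B' I J : finType)
    (K : I -> J -> mat A'' A) (Psi : I -> bop A'' B -> bop A' B') :
  tp_kraus (fun ij : I * J => K ij.1 ij.2) -> (forall i, LOCC (Psi i)) ->
  LOCC (Alice_protocol K Psi).
Proof. by rewrite Alice_protocolE; exact: LOCC_Alice. Qed.

Lemma LOCC_Bob_protocol (A B B'' A' B' I J : finType) (L : I -> J -> mat B'' B)
    (Psi : I -> bop A B'' -> bop A' B') :
  tp_kraus (fun ij : I * J => L ij.1 ij.2) -> (forall i, LOCC (Psi i)) ->
  LOCC (Bob_protocol L Psi).
Proof. by rewrite Bob_protocolE; exact: LOCC_Bob. Qed.

Lemma LOCC_protocol_ind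
    (P : forall A B A' B' : finType, (bop A B -> bop A' B') -> Prop) :
  (forall (A B A' B' I J : finType) (K : I -> mat A' A) (L : J -> mat B' B),
    tp_kraus K -> tp_kraus L -> P _ _ _ _ (local_channel K L)) ->
  (forall (A B A'' A' B' I J : finType) (K : I -> J -> mat A'' A)
      (Psi : I -> bop A'' B -> bop A' B'),
    tp_kraus (fun ij : I * J => K ij.1 ij.2) ->
    (forall i, P _ _ _ _ (Psi i)) -> P _ _ _ _ (Alice_protocol K Psi)) ->
  (forall (A B B'' A' B' I J : finType) (L : I -> J -> mat B'' B)
      (Psi : I -> bop A B'' -> bop A' B'),
    tp_kraus (fun ij : I * J => L ij.1 ij.2) ->
    (forall i, P _ _ _ _ (Psi i)) -> P _ _ _ _ (Bob_protocol L Psi)) ->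
  forall (A B A' B' : finType) (Lam : bop A B -> bop A' B'), LOCC Lam ->
  P _ _ _ _ Lam.
Proof.
move=> Plocal PAlice PBob A B A' B' Lam.
elim=> {A B A' B' Lam} *;
  rewrite -?local_channelE -?Alice_protocolE -?Bob_protocolE.
- exact: Plocal.
- exact: PAlice.
- exact: PBob.
Qed.

End Protocols.

Section SeparableChannels.
Variable R : realType.
Local Notation mat := (mat R).
Local Notation bop := (bop R).

Definition separable_channel (A B A' B' : finType)
    (Lam : bop A B -> bop A' B') :=
  exists2 s : seq (mat A' A * mat B' B),
    Lam = (fun X => \sum_(p <- s) sandw (kron p.1 p.2) X) &
    \sum_(p <- s) mulm (adjm (kron p.1 p.2)) (kron p.1 p.2) = idm (A * B)%type.

Lemma mulm_adjm_kron (T U T' U' : finType) (K : mat T U) (L : mat T' U') :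
  mulm (adjm (kron K L)) (kron K L) = kron (mulm (adjm K) K) (mulm (adjm L) L).
Proof. by rewrite adjm_kron mulm_kron. Qed.

Lemma separable_local_channel (A B A' B' I J : finType) (K : I -> mat A' A)
    (L : J -> mat B' B) :
  tp_kraus K -> tp_kraus L -> separable_channel (local_channel K L).
Proof.
move=> /tp_krausP tpK /tp_krausP tpL.
exists [seq (K i, L j) | i <- index_enum I, j <- index_enum J].
  by apply/funext => X; rewrite big_allpairs_dep.
rewrite big_allpairs_dep -kron_idm -tpK -tpL kron_sum.
by do 2 apply: eq_bigr => ? _; rewrite mulm_adjm_kron.
Qed.

Lemma separable_channel_instrument (A B A'' B'' A' B' I J : finType)
    (K : I -> J -> mat A'' A) (L : I -> J -> mat B'' B)
    (Psi : I -> bop A'' B'' -> bop A' B') :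
  tp_kraus (fun ij : I * J => kron (K ij.1 ij.2) (L ij.1 ij.2)) ->
  (forall i, separable_channel (Psi i)) ->
  separable_channel
    (fun X => \sum_i Psi i (\sum_j sandw (kron (K i j) (L i j)) X)).
Proof.
move=> /tp_krausP tpKL /(_ _)/cid2 sepPsi; pose s i := sval (sepPsi i).
have PsiE i X : Psi i X = \sum_(p <- s i) sandw (kron p.1 p.2) X.
  by rewrite /s; case: (sepPsi i) => t /= ->.
have tp_s i : \sum_(p <- s i) mulm (adjm (kron p.1 p.2)) (kron p.1 p.2) = idm _.
  by rewrite /s; case: (sepPsi i).
exists [seq (mulm p.1 (K ij.1 ij.2), mulm p.2 (L ij.1 ij.2))
  | ij <- index_enum (I * J)%type, p <- s ij.1].
  apply/funext => X; rewrite big_allpairs_dep sum_pair.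
  apply: eq_bigr => i _ /=.
  rewrite PsiE exchange_big; apply: eq_bigr => p _; rewrite raddf_sum.
  by apply: eq_bigr => j _; rewrite /= -sandw_mulm mulm_kron.
rewrite big_allpairs_dep -tpKL; apply: eq_bigr => -[i j] _ /=.
rewrite -[in RHS](mulm1 (adjm _)) -(tp_s i) raddf_sum mulm_suml.
apply: eq_bigr => p _ /=.
by rewrite -mulm_kron adjm_mulm !mulmA.
Qed.

Lemma tp_kraus_kronl (B I T U : finType) (K : I -> mat T U) :
  tp_kraus K -> tp_kraus (fun i => kron (K i) (idm B)).
Proof.
move=> /tp_krausP tpK; apply/tp_krausP; under eq_bigr do rewrite mulm_adjm_kron.
have := kron_sum (index_enum I) [:: tt] (fun i => mulm (adjm (K i)) (K i))
  (fun=> idm B).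
rewrite tpK big_seq1 kron_idm => ->; apply: eq_bigr => i _.
by rewrite big_seq1 adjm_idm mulm1.
Qed.

Lemma tp_kraus_kronr (A I T U : finType) (K : I -> mat T U) :
  tp_kraus K -> tp_kraus (fun i => kron (idm A) (K i)).
Proof.
move=> /tp_krausP tpK; apply/tp_krausP; under eq_bigr do rewrite mulm_adjm_kron.
have := kron_sum [:: tt] (index_enum I) (fun=> idm A)
  (fun i => mulm (adjm (K i)) (K i)).
rewrite tpK !big_seq1 kron_idm => ->; apply: eq_bigr => i _.
by rewrite adjm_idm mulm1.
Qed.

Lemma LOCC_separable (A B A' B' : finType) (Lam : bop A B -> bop A' B') :
  LOCC Lam -> separable_channel Lam.
Proof.
move: A B A' B' Lam; apply: LOCC_protocol_ind.
- exact: separable_local_channel.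
- move=> A B A'' A' B' I J K Psi tpK sepPsi.
  exact/(separable_channel_instrument (tp_kraus_kronl tpK) sepPsi).
- move=> A B B'' A' B' I J L Psi tpL sepPsi.
  exact/(separable_channel_instrument (tp_kraus_kronr tpL) sepPsi).
Qed.

Section ChannelProperties.
Variables (A B A' B' : finType) (Lam : bop A B -> bop A' B').
Hypothesis LOCC_Lam : LOCC Lam.

Lemma LOCC_sum (I : Type) (s : seq I) (X : I -> bop A B) :
  Lam (\sum_(k <- s) X k) = \sum_(k <- s) Lam (X k).
Proof.
have [t -> _] := LOCC_separable LOCC_Lam; rewrite exchange_big.
by apply: eq_bigr => p _; rewrite raddf_sum.
Qed.

Lemma LOCCB X Y : Lam (X - Y) = Lam X - Lam Y.
Proof.
have [t -> _] := LOCC_separable LOCC_Lam; rewrite -sumrB.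
by apply: eq_bigr => p _; rewrite sandwB.
Qed.

Lemma LOCC_hermitian X : hermitian X -> hermitian (Lam X).
Proof.
have [t -> _] := LOCC_separable LOCC_Lam => hermX; rewrite /hermitian raddf_sum.
by apply: eq_bigr => p _; rewrite /= adjm_sandw hermX.
Qed.

Lemma LOCC_hermitianB X Y :
  hermitian X -> hermitian Y -> hermitian (Lam X - Y).
Proof. by move=> /LOCC_hermitian; exact: hermitianB. Qed.

Lemma LOCC_tnorm_le X : hermitian X -> tnorm (Lam X) <= tnorm X.
Proof.
have [t -> tp_t] := LOCC_separable LOCC_Lam => hermX.
apply: tnorm_le => M contrM.
pose N := \sum_(p <- t) sandw (adjm (kron p.1 p.2)) M.
have -> : trm (mulm M (\sum_(p <- t) sandw (kron p.1 p.2) X)) = trm (mulm N X).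
  by rewrite mulm_suml !raddf_sum; apply: eq_bigr => p _;
    rewrite /= trm_mulm_sandw.
apply: normc_trm_le_tnorm => // w.
rewrite /N qform_sum (le_trans (normc_sum _ _ _))//.
rewrite -(sum_sqnorm_appm w tp_t).
by apply: ler_sum => p _; rewrite qform_sandw adjmK.
Qed.

End ChannelProperties.
End SeparableChannels.

Section Closure.
Variable R : realType.
Local Notation mat := (mat R).
Local Notation bop := (bop R).

Lemma tp_kraus_unit (I T U : finType) (K : I -> mat T U) :
  tp_kraus K -> tp_kraus (fun ij : unit * I => K ij.2).
Proof.
by move=> /tp_krausP tpK; apply/tp_krausP; rewrite sum_pair sum_unit.
Qed.

Lemma LOCC_comp (A B A' B' A'' B'' : finType) (Lam : bop A B -> bop A' B')
    (Lam' : bop A' B' -> bop A'' B'') : LOCC Lam -> LOCC Lam' ->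
  LOCC (Lam' \o Lam).
Proof.
move=> loccLam; move: A'' B'' Lam'; move: A B A' B' Lam loccLam.
apply: LOCC_protocol_ind.
- move=> A B A' B' I J K L tpK tpL A'' B'' Lam' loccLam'.
  pose K' (_ : unit) := K; pose L' (_ : unit) := L.
  have -> : Lam' \o local_channel K L
      = Alice_protocol K' (fun=> Bob_protocol L' (fun=> Lam')).
    apply/funext => X; rewrite /= /Alice_protocol /Bob_protocol !sum_unit.
    rewrite /local_channel exchange_big; congr Lam'; apply: eq_bigr => j _.
    rewrite raddf_sum; apply: eq_bigr => i _.
    by rewrite /= -sandw_mulm mulm_kron mulm1 mul1m.
  apply: LOCC_Alice_protocol => [|_]; first exact: tp_kraus_unit.
  by apply: LOCC_Bob_protocol => //; exact: tp_kraus_unit.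
- move=> A B A'' A' B' I J K Psi tpK loccPsi A2 B2 Lam' loccLam'.
  have -> : Lam' \o Alice_protocol K Psi
      = Alice_protocol K (fun i => Lam' \o Psi i).
    by apply/funext => X; exact: LOCC_sum.
  by apply: LOCC_Alice_protocol => // i; exact: loccPsi.
- move=> A B B'' A' B' I J L Psi tpL loccPsi A2 B2 Lam' loccLam'.
  have -> : Lam' \o Bob_protocol L Psi
      = Bob_protocol L (fun i => Lam' \o Psi i).
    by apply/funext => X; exact: LOCC_sum.
  by apply: LOCC_Bob_protocol => // i; exact: loccPsi.
Qed.

Lemma swapopK (A B : finType) (X : bop A B) : swapop (swapop X) = X.
Proof. by apply: matP => -[a b] [a' b']. Qed.

Lemma swapopB (A B : finType) (X Y : bop A B) :
  swapop (X - Y) = swapop X - swapop Y.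
Proof. by []. Qed.

HB.instance Definition _ (A B : finType) :=
  GRing.isZmodMorphism.Build (bop A B) (bop B A) swapop (@swapopB A B).

Lemma mulm_swapop (A B : finType) (X Y : bop A B) :
  mulm (swapop X) (swapop Y) = swapop (mulm X Y).
Proof.
by apply: matP => x y; rewrite /mulm /swapop sum_swap; apply: eq_bigr => -[].
Qed.

Lemma trm_swapop (A B : finType) (X : bop A B) : trm (swapop X) = trm X.
Proof. by rewrite /trm [RHS]sum_swap. Qed.

Lemma swapop_sandw_kron (A B A' B' : finType) (K : mat A' A) (L : mat B' B) X :
  swapop (sandw (kron K L) (swapop X)) = sandw (kron L K) X.
Proof.
apply: matP => x y; rewrite /swapop /sandw /mulm sum_swap.
apply: eq_bigr => -[b a] _.
rewrite sum_swap /adjm /kron /=; congr (_ * conjc _); last exact: mulrC.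
by apply: eq_bigr => -[b' a'] _; rewrite [K _ _ * _]mulrC.
Qed.

Lemma LOCC_swap (A B A' B' : finType) (Lam : bop A B -> bop A' B') :
  LOCC Lam -> LOCC (fun X => swapop (Lam (swapop X))).
Proof.
move: A B A' B' Lam; apply: LOCC_protocol_ind.
- move=> A B A' B' I J K L tpK tpL.
  have -> : (fun X => swapop (local_channel K L (swapop X)))
      = local_channel L K.
    apply/funext => X; rewrite raddf_sum [RHS]exchange_big.
    apply: eq_bigr => i _.
    by rewrite /= raddf_sum; apply: eq_bigr => j _; exact: swapop_sandw_kron.
  exact: LOCC_local_channel.
- move=> A B A'' A' B' I J K Psi tpK loccPsi.
  have -> : (fun X => swapop (Alice_protocol K Psi (swapop X)))
      = Bob_protocol K (fun i Y => swapop (Psi i (swapop Y))).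
    apply/funext => X; rewrite raddf_sum; apply: eq_bigr => i _ /=.
    rewrite raddf_sum.
    congr (swapop (Psi i _)); apply: eq_bigr => j _.
    by rewrite -swapop_sandw_kron swapopK.
  exact: LOCC_Bob_protocol.
- move=> A B B'' A' B' I J L Psi tpL loccPsi.
  have -> : (fun X => swapop (Bob_protocol L Psi (swapop X)))
      = Alice_protocol L (fun i Y => swapop (Psi i (swapop Y))).
    apply/funext => X; rewrite raddf_sum; apply: eq_bigr => i _ /=.
    rewrite raddf_sum.
    congr (swapop (Psi i _)); apply: eq_bigr => j _.
    by rewrite -swapop_sandw_kron swapopK.
  exact: LOCC_Alice_protocol.
Qed.

Lemma hermitian_swapop (A B : finType) (X : bop A B) :
  hermitian X -> hermitian (swapop X).
Proof. by rewrite /hermitian => {2}<-. Qed.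

Lemma qform_swapop (A B : finType) (X : bop A B) w :
  qform (swapop X) w = qform X (fun i => w (i.2, i.1)).
Proof.
rewrite !qformE sum_swap; apply: eq_bigr => -[a b] _.
by rewrite sum_swap; apply: eq_bigr => -[].
Qed.

Lemma tnorm_swapop_le (A B : finType) (X : bop A B) :
  hermitian X -> tnorm (swapop X) <= tnorm X.
Proof.
move=> hermX; apply: tnorm_le => M contrM.
rewrite -(swapopK M) mulm_swapop trm_swapop; apply: normc_trm_le_tnorm => // w.
rewrite qform_swapop (le_trans (contrM _))// /sqnorm [leRHS]sum_swap.
by rewrite lexx.
Qed.

End Closure.

(** * Maximally entangled states *)

Section MaximallyEntangled.
Variable R : realType.
Local Notation C := R[i].
Local Notation mat := (mat R).
Local Notation bop := (bop R).

Definition maxent_vec (D : finType) : D * D -> C :=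
  fun p => (Num.sqrt #|D|%:R^-1)%:C * (p.1 == p.2)%:R.

Definition maxent (D : finType) : bop D D :=
  outer (@maxent_vec D) (@maxent_vec D).
Arguments maxent D : clear implicits.

Lemma sqrtC_sqr (x : R) : 0 <= x -> (Num.sqrt x)%:C * (Num.sqrt x)%:C = x%:C.
Proof. by move=> x_ge0; rewrite -rmorphM -expr2 sqr_sqrtr. Qed.

Lemma maxentE (D : finType) x y :
  maxent D x y = #|D|%:R^-1 * (x.1 == x.2)%:R * (y.1 == y.2)%:R.
Proof.
rewrite /maxent /outer /maxent_vec rmorphM /= conjc_nat oppr0 complexr0 mulrACA
  -[RHS]mulrA.
by rewrite sqrtC_sqr ?invr_ge0// fmorphV rmorph_nat.
Qed.

Lemma appm_kron_maxent_vec (A B D : finType) (K : mat A D) (L : mat B D) :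
  appm (kron K L) (@maxent_vec D)
  = scalev (Num.sqrt #|D|%:R^-1)%:C (\sum_i kronv (K^~ i) (L^~ i)).
Proof.
apply/funext => x; rewrite /scalev fct_sumE mulr_sumr.
rewrite -[RHS](sum_delta_diag (fun p => _ * (K x.1 p.1 * L x.2 p.2))).
by apply: eq_bigr => p _; rewrite /kron /maxent_vec; ring.
Qed.

Lemma sqnorm_maxent_vec (D : finType) :
  (0 < #|D|)%N -> sqnorm (@maxent_vec D) = 1.
Proof.
move=> D_gt0; rewrite /sqnorm /maxent_vec.
transitivity (\sum_(p : D * D) (p.1 == p.2)%:R * (#|D|%:R^-1 : R)).
  apply: eq_bigr => p _.
  rewrite sqmodM sqmod_real sqmod_nat sqr_sqrtr ?invr_ge0//.
  by case: eqP => _; rewrite ?expr0n ?expr1n mulrC.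
by rewrite sum_delta_diag sumr_const -[LHS]mulr_natr mulVf// pnatr_eq0 -lt0n.
Qed.

Lemma is_state_maxent (D : finType) : (0 < #|D|)%N -> is_state (maxent D).
Proof. by move=> /sqnorm_maxent_vec; exact: is_state_outer. Qed.

Lemma psi_plusE : psi_plus = maxent 'I_2.
Proof.
apply: matP => x y; rewrite maxentE card_ord /psi_plus -mulrA -natrM mulnb.
by case: ifP => _; rewrite ?mulr1 ?mulr0.
Qed.

Lemma tpow_maxent (D : finType) n : tpow (maxent D) n = maxent {ffun 'I_n -> D}.
Proof.
apply: matP => x y; rewrite maxentE !natr_eq_ffun /tpow.
under [LHS]eq_bigr do rewrite maxentE.
by rewrite !big_split prodr_const /= card_ffun card_ord natrX exprVn.
Qed.

Lemma swapop_psi_plus : swapop psi_plus = psi_plus :> bop _ _.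
Proof.
rewrite psi_plusE; apply: matP => x y.
by rewrite /swapop !maxentE /= [x.2 == _]eq_sym [y.2 == _]eq_sym.
Qed.

Lemma is_state_psi_plus : is_state (@psi_plus R).
Proof. by rewrite psi_plusE; apply: is_state_maxent; rewrite card_ord. Qed.

Lemma is_state_swapop (A B : finType) (rho : bop A B) :
  is_state rho -> is_state (swapop rho).
Proof.
move=> [/psdP psd_rho rho1]; split; last by rewrite trm_swapop.
by apply/psdP => w; rewrite qform_swapop.
Qed.

Lemma hermitian_tpow (A B : finType) (rho : bop A B) n :
  hermitian rho -> hermitian (tpow rho n).
Proof.
move=> herm_rho; apply: matP => x y; rewrite /adjm /tpow rmorph_prod.
by apply: eq_bigr => k _; rewrite -[in RHS]herm_rho.
Qed.

Lemma trm_tpow (A B : finType) (rho : bop A B) n :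
  trm (tpow rho n) = trm rho ^+ n.
Proof.
rewrite /trm /tpow -(prod_sum_pair (fun (k : 'I_n) p => rho p p)).
by rewrite prodr_const card_ord.
Qed.

Lemma psd_sum (T : finType) (I : Type) (s : seq I) (X : I -> mat T T) :
  (forall k, psd (X k)) -> psd (\sum_(k <- s) X k).
Proof.
move=> psdX; apply/psdP => w; rewrite qform_sum sumr_ge0// => k _.
by have /psdP := psdX k; exact.
Qed.

Lemma is_state_tpow (A B : finType) (rho : bop A B) n :
  is_state rho -> is_state (tpow rho n).
Proof.
move=> [/psd_sum_outer[phi rhoE] rho1]; split;
  last by rewrite trm_tpow rho1 expr1n.
pose phin (f : {ffun 'I_n -> A * B}) :=
  fun x : {ffun 'I_n -> A} * {ffun 'I_n -> B} =>
    \prod_k phi (f k) (x.1 k, x.2 k).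
suff -> : tpow rho n = \sum_f outer (phin f) (phin f).
  by apply: psd_sum => f; exact: psd_outer.
apply: matP => x y; rewrite /tpow rhoE mat_sumE.
under eq_bigr do rewrite mat_sumE.
by rewrite bigA_distr_bigA; apply: eq_bigr => f _;
  rewrite big_split /outer rmorph_prod.
Qed.

End MaximallyEntangled.

Arguments maxent {R} D.

(** * Transition rates *)

Section Achievability.
Variable R : realType.
Local Notation C := R[i].
Local Notation mat := (mat R).
Local Notation bop := (bop R).

Lemma sum_outer_basis (T : finType) :
  \sum_t outer (basisv t) (basisv t) = idm T :> mat T T.
Proof.
apply: qform_inj => w; rewrite qform_sum qform_idm rmorph_sum.
by apply: eq_bigr => t _; rewrite qform_outer vdot_basisl.
Qed.

Lemma tp_kraus_replace (T U : finType) (u : U -> C) :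
  sqnorm u = 1 -> tp_kraus (fun t : T => outer u (basisv t)).
Proof.
move=> u1; apply/tp_krausP; rewrite -sum_outer_basis; apply: eq_bigr => t _.
rewrite adjm_outer mulm_outer appm_outer vdotvv u1; congr outer.
by apply/funext => x; rewrite /scalev mul1r.
Qed.

Definition replace_channel (A B A' B' : finType) (a : A' -> C) (b : B' -> C) :
  bop A B -> bop A' B' :=
  fun X x y => trm X * outer (kronv a b) (kronv a b) x y.

Lemma LOCC_replace_channel (A B A' B' : finType) (a : A' -> C) (b : B' -> C) :
  sqnorm a = 1 -> sqnorm b = 1 -> LOCC (@replace_channel A B A' B' a b).
Proof.
move=> /(@tp_kraus_replace A) tpKa /(@tp_kraus_replace B) tpKb.
have := LOCC_local_channel tpKa tpKb; rewrite local_channelE; congr (LOCC _).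
apply/funext => X; apply: matP => x y.
rewrite /replace_channel /trm sum_pair mulr_suml.
apply: eq_bigr => i _; rewrite mulr_suml; apply: eq_bigr => j _.
by rewrite kron_outer kronv_basis sandw_outerl /qform vdot_appm_basis /outer
  mulrA.
Qed.

Section Achievable.
Variables (A B A' B' : finType) (rho : bop A B) (sigma : bop A' B').

Lemma achievable0 : trm rho = 1 -> achievable rho sigma 0.
Proof.
move=> rho1; split => //; exists (fun=> 0%N).
pose one (T : finType) (_ : {ffun 'I_0 -> T}) : C := 1.
have one1 T : sqnorm (@one T) = 1.
  by rewrite /sqnorm /one sumr_const card_ffun card_ord -[1]/(1%:R) sqmod_nat
    expr1n.
exists (fun n => replace_channel (@one A') (@one B')).
split=> [n|]; first by apply: LOCC_replace_channel; exact: one1.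
split; first by under eq_fun do rewrite mul0r; exact: cvg_cst.
rewrite (_ : (fun n => _) = fun=> 0); first exact: cvg_cst.
apply/funext => n; rewrite (_ : subm _ _ = 0) ?tnorm0// submE.
apply/eqP; rewrite subr_eq0; apply/eqP; apply: matP => x y.
by rewrite /replace_channel trm_tpow rho1 expr1n /outer /kronv !mul1r conjc1
  /tpow big_ord0.
Qed.

Lemma achievable_swap r : is_state rho -> is_state sigma ->
  achievable rho sigma r -> achievable (swapop rho) (swapop sigma) r.
Proof.
move=> /state_hermitian herm_rho /state_hermitian herm_sigma
  [r_ge0 [m [Lam [locc [m_ratio err0]]]]].
split=> //; exists m, (fun n X => swapop (Lam n (swapop X))); split=> [n|].
  exact: LOCC_swap.
split=> //; apply: (squeeze_cvgr _ (cvg_cst 0) err0); apply: nearW => n.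
have herm_err : hermitian (Lam n (tpow rho n) - tpow sigma (m n)).
  by apply: LOCC_hermitianB => //; exact: hermitian_tpow.
apply/andP; split; last exact: (tnorm_swapop_le herm_err).
exact: (tnorm_ge0 (hermitian_swapop herm_err)).
Qed.

End Achievable.

Lemma cvgny_ratio (m : nat -> nat) (r : R) : 0 < r ->
  (fun n => (m n)%:R / n%:R : R) @ \oo --> r -> m @ \oo --> \oo.
Proof.
move=> r_gt0 m_ratio; apply/cvgnyPge => N; near=> n.
have n_gt0 : (0 : R) < n%:R by rewrite ltr0n; near: n; exact: nbhs_infty_gt.
have : r / 2 < (m n)%:R / n%:R by near: n; apply: (cvgr_gt _ m_ratio); lra.
rewrite ltr_pdivlMr// -(ler_nat R) => /ltW; apply: le_trans.
rewrite [leRHS]mulrC -ler_pdivrMr ?divr_gt0//; near: n; exact: nbhs_infty_ger.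
Unshelve. all: by end_near. Qed.

Lemma cvg_ratio_comp (m1 m2 : nat -> nat) (r1 r2 : R) : 0 < r1 ->
  (fun n => (m1 n)%:R / n%:R : R) @ \oo --> r1 ->
  (fun n => (m2 n)%:R / n%:R : R) @ \oo --> r2 ->
  (fun n => (m2 (m1 n))%:R / n%:R : R) @ \oo --> r1 * r2.
Proof.
move=> r1_gt0 m1_ratio m2_ratio; have m1y := cvgny_ratio r1_gt0 m1_ratio.
apply: cvg_trans (cvgM m1_ratio (cvg_comp _ _ m1y m2_ratio)).
apply: near_eq_cvg.
have /cvgnyPge/(_ 1%N) := m1y; apply: filterS => n m1_gt0 /=.
by rewrite mulrC mulrA divfK// pnatr_eq0 -lt0n.
Qed.

Lemma achievable_trans (A B A' B' A'' B'' : finType) (rho : bop A B)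
    (sigma : bop A' B') (tau : bop A'' B'') r1 r2 :
  is_state rho -> is_state sigma -> is_state tau ->
  achievable rho sigma r1 -> achievable sigma tau r2 ->
  achievable rho tau (r1 * r2).
Proof.
move=> state_rho /state_hermitian herm_sigma /state_hermitian herm_tau.
move=> [r1_ge0 [m1 [L1 [locc1 [m1_ratio err1]]]]]
  [r2_ge0 [m2 [L2 [locc2 [m2_ratio err2]]]]].
have [->|r1_neq0] := eqVneq r1 0.
  by rewrite mul0r; exact: achievable0 state_rho.2.
have r1_gt0 : 0 < r1 by rewrite lt_neqAle eq_sym r1_neq0.
split; first exact: mulr_ge0.
exists (m2 \o m1), (fun n => L2 (m1 n) \o L1 n).
split=> [n|]; first exact: LOCC_comp.
split; first exact: (cvg_ratio_comp r1_gt0 m1_ratio m2_ratio).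
have err2_m1 := cvg_comp _ _ (cvgny_ratio r1_gt0 m1_ratio) err2.
have err : (fun n => tnorm (L1 n (tpow rho n) - tpow sigma (m1 n))
    + tnorm (L2 (m1 n) (tpow sigma (m1 n)) - tpow tau (m2 (m1 n))))
    @ \oo --> (0 : R).
  by rewrite -[0](addr0 0); exact: (cvgD err1 err2_m1).
apply: (squeeze_cvgr _ (cvg_cst 0) err); apply: nearW => n /=; rewrite submE.
have herm_err1 : hermitian (L1 n (tpow rho n) - tpow sigma (m1 n)).
  apply: LOCC_hermitianB => //; last exact: hermitian_tpow.
  by apply: hermitian_tpow; exact: state_hermitian.
have herm_err2 :
    hermitian (L2 (m1 n) (tpow sigma (m1 n)) - tpow tau (m2 (m1 n))).
  by apply: LOCC_hermitianB => //; exact: hermitian_tpow.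
have -> : L2 (m1 n) (L1 n (tpow rho n)) - tpow tau (m2 (m1 n))
    = L2 (m1 n) (L1 n (tpow rho n) - tpow sigma (m1 n))
      + (L2 (m1 n) (tpow sigma (m1 n)) - tpow tau (m2 (m1 n))).
  by rewrite (LOCCB (locc2 _)) subrKA.
have herm_L2_err1 := LOCC_hermitian (locc2 (m1 n)) herm_err1.
rewrite tnorm_ge0 ?(le_trans (ler_tnormD herm_L2_err1 herm_err2)) ?lerD2r
  ?LOCC_tnorm_le//.
by rewrite /hermitian raddfD /= herm_L2_err1 herm_err2.
Qed.

End Achievability.

Section Rates.
Local Open Scope ereal_scope.
Variable R : realType.
Local Notation bop := (bop R).

Lemma ge_ereal_supMr (S : set (\bar R)) (y c : \bar R) : 0 <= y -> 0 <= c ->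
  (forall x, S x -> x * y <= c) -> ereal_sup S * y <= c.
Proof.
case: y => [y| |] // y_ge0 c_ge0 Sy; last first.
  have [sup_gt0|sup_le0] := ltP 0 (ereal_sup S); last first.
    by rewrite (le_trans _ c_ge0)// mule_le0_ge0.
  have [x Sx x_gt0] := ereal_sup_gt sup_gt0.
  by have := Sy _ Sx; rewrite gt0_muley// leye_eq => /eqP ->; rewrite leey.
have [<-|y_neq0] := eqVneq 0%R y; first by rewrite mule0.
have y_gt0 : (0 < y)%R by rewrite lt_neqAle y_neq0.
rewrite -lee_pdivlMr//; apply: ge_ereal_sup => x Sx.
by rewrite lee_pdivlMr// Sy.
Qed.

Section RateProperties.
Variables (A B A' B' : finType) (rho : bop A B) (sigma : bop A' B').
Hypotheses (state_rho : is_state rho) (state_sigma : is_state sigma).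

Lemma rate_ge0 : 0 <= rate rho sigma.
Proof.
by apply: ereal_sup_ubound; exists 0%R => //; exact: achievable0 state_rho.2.
Qed.

Lemma rate_swap : rate (swapop rho) (swapop sigma) = rate rho sigma.
Proof.
congr ereal_sup; apply/seteqP; split=> _ [r ach <-]; exists r => //.
  rewrite -[rho]swapopK -[sigma]swapopK.
  by apply: achievable_swap ach; exact: is_state_swapop.
exact: achievable_swap.
Qed.

End RateProperties.

Lemma rate_trans (A B A' B' A'' B'' : finType) (rho : bop A B)
    (sigma : bop A' B') (tau : bop A'' B'') :
  is_state rho -> is_state sigma -> is_state tau ->
  rate rho sigma * rate sigma tau <= rate rho tau.
Proof.
move=> state_rho state_sigma state_tau.
have rate_rho_ge0 := rate_ge0 _ state_rho.
apply: ge_ereal_supMr => [||_ [r1 ach1 <-]]; rewrite ?rate_ge0//.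
rewrite muleC; apply: ge_ereal_supMr => [||_ [r2 ach2 <-]]; rewrite ?rate_ge0//.
  by rewrite lee_fin; case: ach1.
rewrite -EFinM mulrC; apply: ereal_sup_ubound; exists (r1 * r2)%R => //.
exact: achievable_trans ach1 ach2.
Qed.

End Rates.

(** * Teleportation *)

Section UnitaryErrorBases.
Variable R : realType.
Local Notation C := R[i].
Local Notation mat := (mat R).

Definition unitary_error_basis (D : finType) (U : D * D -> mat D D) :=
  (forall q, unitary (U q)) /\
  (forall y y' z z', \sum_q U q y z * conjc (U q y' z')
     = #|D|%:R * (y == y')%:R * (z == z')%:R).

Lemma unitary_error_basis_qubit : exists U : 'I_2 * 'I_2 -> mat 'I_2 'I_2,
  unitary_error_basis U.
Proof.
pose U (q : 'I_2 * 'I_2) (y z : 'I_2) : C :=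
  ((y != z) == (q.1 != 0))%:R * (-1) ^+ ((q.2 != 0) && (z != 0)).
have UJ q y z : conjc (U q y z) = U q y z.
  by rewrite rmorphM rmorphXn rmorphN1 /= conjc_nat.
have sum2 (F : 'I_2 -> C) : \sum_i F i = F ord0 + F (lift ord0 ord0).
  by rewrite !big_ord_recl big_ord0 addr0.
have ind2 (P : 'I_2 -> Prop) : P ord0 -> P (lift ord0 ord0) -> forall i, P i.
  by move=> P0 P1 i; case: (unliftP ord0 i) => [j|] -> //; rewrite (ord1 j).
exists U; split=> [[u t]|y y' z z'].
  apply: matP => y z; rewrite /mulm /adjm /idm sum2 !UJ /U.
  by elim/ind2: u; elim/ind2: t; elim/ind2: y; elim/ind2: z; rewrite /=; ring.
rewrite sum_pair !sum2 !UJ /U card_ord.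
by elim/ind2: y; elim/ind2: y'; elim/ind2: z; elim/ind2: z'; rewrite /=; ring.
Qed.

Lemma unitary_error_basis_ffun (I D : finType) (U : D * D -> mat D D) :
  unitary_error_basis U ->
  unitary_error_basis (fun (q : {ffun I -> D} * {ffun I -> D}) x y =>
    \prod_k U (q.1 k, q.2 k) (x k) (y k)).
Proof.
move=> [unitaryU Uorth]; split=> [q|y y' z z'].
  apply: matP => x y; rewrite /mulm /adjm /idm natr_eq_ffun.
  under [LHS]eq_bigr do rewrite rmorph_prod -big_split /=.
  rewrite -(bigA_distr_bigA (fun k t => conjc (U (q.1 k, q.2 k) t (x k))
    * U (q.1 k, q.2 k) t (y k))); apply: eq_bigr => k _.
  by rewrite -[RHS]/(idm D (x k) (y k)) -(unitaryU (q.1 k, q.2 k)).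
under [LHS]eq_bigr do rewrite rmorph_prod -big_split /=.
rewrite -(prod_sum_pair
  (fun k q => U q (y k) (z k) * conjc (U q (y' k) (z' k)))).
under [LHS]eq_bigr do rewrite Uorth.
by rewrite !big_split prodr_const /= card_ffun natrX !natr_eq_ffun.
Qed.

Lemma sandw_entry (T U : finType) (K : mat T U) (X : mat U U) x y :
  sandw K X x y = \sum_i \sum_j K x i * X i j * conjc (K y j).
Proof.
rewrite /sandw /mulm /adjm exchange_big; apply: eq_bigr => j _ /=.
by rewrite mulr_suml.
Qed.

Lemma unitary_error_basis_twirl (D : finType) (U : D * D -> mat D D)
    (X : mat D D) :
  unitary_error_basis U ->
  \sum_q sandw (adjm (U q)) X = fun z z' => #|D|%:R * trm X * idm D z z'.
Proof.
move=> [_ Uorth]; apply: matP => z z'; rewrite mat_sumE.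
under eq_bigr do rewrite sandw_entry.
rewrite exchange_big mulrAC mulr_sumr; apply: eq_bigr => i _ /=.
rewrite exchange_big
  -[RHS](sum_delta i (fun j => #|D|%:R * idm D z z' * X i j)).
apply: eq_bigr => j _ /=.
transitivity (X i j * \sum_q U q j z' * conjc (U q i z)).
  by rewrite mulr_sumr; apply: eq_bigr => q _; rewrite /adjm conjcK; ring.
by rewrite Uorth /idm [j == i]eq_sym [z' == z]eq_sym; ring.
Qed.

End UnitaryErrorBases.

Section Teleportation.
Variable R : realType.
Local Notation C := R[i].
Local Notation mat := (mat R).
Local Notation bop := (bop R).

Definition unvec (A D : finType) (w : A * D -> C) : mat A D :=
  fun a d => w (a, d).

Definition conjm (T U : finType) (K : mat T U) : mat T U :=
  fun i j => conjc (K i j).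

Lemma unitary_conjm (T : finType) (U : mat T T) :
  unitary U -> unitary (conjm U).
Proof.
move=> unitaryU; apply: matP => x y.
rewrite -[idm T x y]conjc_nat -[RHS]/(conjc (idm T x y)) -unitaryU.
by rewrite rmorph_sum; apply: eq_bigr => i _; rewrite rmorphM.
Qed.

Lemma trm_unvec (A D : finType) (w : A * D -> C) :
  trm (mulm (adjm (unvec w)) (unvec w)) = (sqnorm w)%:C.
Proof. by rewrite -vdotvv /vdot sum_pair exchange_big. Qed.

(* The transposition trick: an operator on one half of the maximally entangled
   vector acts as its transpose on the other half. *)
Lemma appm_kron_conjm_maxent_vec (A B D : finType) (K : mat A D) (L : mat B D) :
  appm (kron K (conjm L)) (@maxent_vec R D)
  = scalev (Num.sqrt #|D|%:R^-1)%:C (fun x => mulm K (adjm L) x.1 x.2).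
Proof.
rewrite appm_kron_maxent_vec; congr scalev.
by apply/funext => x; rewrite fct_sumE.
Qed.

Section Protocol.
Variables (A D S : finType) (U : D * D -> mat D D) (phi : S -> A * D -> C).
Hypothesis ueb : unitary_error_basis U.
Hypothesis D_neq0 : #|D|%:R != 0 :> R.

(* Alice projects the second half of [phi s] and her half of the resource on
   the maximally entangled vector rotated by [U q]. *)
Definition teleportation_kraus (q : D * D) (s : S) : mat A D :=
  mulm (unvec (scalev (Num.sqrt #|D|%:R^-1)%:C (phi s))) (U q).

Lemma tp_teleportation_kraus : \sum_s sqnorm (phi s) = 1 ->
  tp_kraus (fun qs : (D * D) * S => teleportation_kraus qs.1 qs.2).
Proof.
move=> phi1; apply/tp_krausP; rewrite sum_pair exchange_big.
apply: matP => z z'.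
rewrite mat_sumE -[RHS]mul1r -[1]/(1%:C) -phi1 rmorph_sum mulr_suml.
apply: eq_bigr => s _ /=.
pose Phi := unvec (scalev (Num.sqrt #|D|%:R^-1)%:C (phi s)).
have -> : \sum_q mulm (adjm (teleportation_kraus q s)) (teleportation_kraus q s)
    = \sum_q sandw (adjm (U q)) (mulm (adjm Phi) Phi).
  by apply: eq_bigr => q _; rewrite /sandw adjmK adjm_mulm !mulmA.
rewrite unitary_error_basis_twirl// trm_unvec sqnormZ sqmod_real sqr_sqrtr
  ?invr_ge0//.
by rewrite -(rmorph_nat (real_complex R)) -rmorphM mulVKf.
Qed.

Lemma teleportation_branch q s x y :
  sandw (kron (teleportation_kraus q s) (conjm (U q))) (maxent D) x y
  = #|D|%:R ^- 2 * outer (phi s) (phi s) x y.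
Proof.
rewrite sandw_outer appm_kron_conjm_maxent_vec /teleportation_kraus -mulmA.
rewrite (mulm1C (ueb.1 q)) mulm1 /outer /scalev /unvec -!surjective_pairing.
rewrite !rmorphM /= oppr0 complexr0 -(rmorph_nat (real_complex R)) -rmorphXn
  -fmorphV /=.
set c := Num.sqrt _; have <- : c ^+ 4 = #|D|%:R ^- 2.
  by rewrite (exprM c 2 2) sqr_sqrtr ?invr_ge0// exprVn.
by rewrite rmorphXn /=; ring.
Qed.

End Protocol.

Theorem teleportation (A D : finType) (U : D * D -> mat D D) (omega : bop A D) :
  unitary_error_basis U -> is_state omega ->
  exists2 Lam : bop D D -> bop A D, LOCC Lam & Lam (maxent D) = omega.
Proof.
move=> ueb [/psd_sum_outer[phi ->]]; rewrite raddf_sum /= => omega1.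
have D_neq0 : #|D|%:R != 0 :> R.
  rewrite pnatr_eq0; apply: contra_eqN omega1 => D0.
  rewrite big1 1?eq_sym ?oner_eq0// => -[a d].
  by have := fintype0 d; rewrite (eqP D0) => /(_ erefl).
exists (Alice_protocol (teleportation_kraus U phi) (fun q =>
    local_channel (fun _ : unit => idm A) (fun _ : unit => conjm (U q)))).
  apply: LOCC_Alice_protocol => [|q].
    apply: tp_teleportation_kraus => //; apply: complexI.
    rewrite rmorph1 -omega1 rmorph_sum.
    by apply: eq_bigr => s _; rewrite trm_outer vdotvv.
  apply: LOCC_local_channel; apply/tp_krausP; rewrite sum_unit;
    first exact: unitary_idm.
  exact/unitary_conjm/ueb.1.
apply: matP => x y; rewrite /Alice_protocol !mat_sumE.
transitivity (\sum_(q : D * D) \sum_s #|D|%:R ^- 2 * outer (phi s) (phi s) x y).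
  apply: eq_bigr => q _; rewrite /local_channel !sum_unit raddf_sum mat_sumE.
  apply: eq_bigr => s _; rewrite -(teleportation_branch phi ueb q) /=.
  by rewrite -sandw_mulm mulm_kron mul1m mulm1.
rewrite sumr_const card_prod -mulr_sumr -mulrnAl -mulr_natr natrM -expr2 mulVf
  ?mul1r//.
by rewrite expf_neq0// pnatr_eq0 -(pnatr_eq0 R).
Qed.

End Teleportation.

(** * Positivity of the preparation rate *)

Section Preparation.
Variable R : realType.
Local Notation mat := (mat R).
Local Notation bop := (bop R).

Lemma isometry_decoder (T U : finType) (V : mat U T) (t0 : T) :
  mulm (adjm V) V = idm T ->
  exists2 K : unit + U -> mat T U, tp_kraus K &
    forall k, mulm (K k) V = if k is inl _ then idm T else 0.
Proof.
move=> isoV; pose P := idm U - mulm V (adjm V).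
have hermP : adjm P = P by rewrite adjmB adjm_idm adjm_mulm adjmK.
have PV : mulm P V = 0 by rewrite mulmBl mul1m -mulmA isoV mulm1 subrr.
have projP : mulm P P = P by rewrite {2}/P mulmBr mulm1 mulmA PV mul0m subr0.
pose reset y := outer (basisv t0) (basisv y) : mat T U.
have /tp_krausP tp_reset : tp_kraus reset.
  by apply: tp_kraus_replace; exact: sqnorm_basis.
exists (fun k => match k with inl _ => adjm V | inr y => mulm (reset y) P end).
  apply/tp_krausP; rewrite big_sumType sum_unit adjmK.
  rewrite (eq_bigr (fun y => sandw P (mulm (adjm (reset y)) (reset y))))
    => [|y _].
    rewrite -(raddf_sum (sandw P)) tp_reset /= /sandw mulm1 hermP projP.
    by rewrite addrC subrK.
  by rewrite adjm_mulm /sandw hermP !mulmA.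
by case=> [_|y] //; rewrite -mulmA PV raddf0.
Qed.

Lemma injection_of_card (T U : finType) : (#|T| <= #|U|)%N ->
  exists f : T -> U, injective f.
Proof.
move=> card_le.
exists (fun x => enum_val (widen_ord card_le (enum_rank x))) => x y.
by move=> /enum_val_inj/(congr1 val)/= /val_inj/enum_rank_inj.
Qed.

Lemma isometry_of_card (T U : finType) : (#|T| <= #|U|)%N ->
  exists V : mat U T, mulm (adjm V) V = idm T.
Proof.
move=> /injection_of_card[f f_inj]; exists (fun u t => (f t == u)%:R).
apply: matP => t t'; rewrite /mulm /adjm; under eq_bigr do rewrite conjc_nat.
by rewrite sum_delta /idm (inj_eq f_inj) eq_sym.
Qed.

Lemma LOCC_state_preparation (A B D : finType) (U : D * D -> mat D D)
    (rho : bop A B) :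
  unitary_error_basis U -> (#|B| <= #|D|)%N -> is_state rho ->
  exists2 Lam : bop D D -> bop A B, LOCC Lam & Lam (maxent D) = rho.
Proof.
move=> ueb /isometry_of_card[V isoV] [psd_rho rho1].
have [[_ b0]] := trm1_inhabited rho1.
have isoVA : mulm (adjm (kron (idm A) V)) (kron (idm A) V) = idm _.
  by rewrite mulm_adjm_kron adjm_idm mulm1 isoV kron_idm.
pose omega := sandw (kron (idm A) V) rho.
have [|Lam locc LamE] := teleportation (omega := omega) ueb.
  split; first exact: psd_sandw.
  by rewrite -(mul1m omega) trm_mulm_sandw /sandw mulm1 adjmK isoVA mul1m.
have [K tpK KV] := isometry_decoder b0 isoV.
exists (local_channel (fun _ : unit => idm A) K \o Lam).
  apply: LOCC_comp => //; apply: LOCC_local_channel => //.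
  by apply/tp_krausP; rewrite sum_unit; exact: unitary_idm.
rewrite /= LamE /local_channel sum_unit big_sumType sum_unit big1 => [|y _].
  by rewrite /= addr0 -sandw_mulm mulm_kron KV mulm1 kron_idm sandw_idm.
rewrite -sandw_mulm mulm_kron KV; apply: matP => x x'.
by rewrite sandw_entry !big1// => i _; rewrite big1// => j _;
  rewrite /kron mulr0 !mul0r.
Qed.

Lemma cvg_divn (l : nat) : (0 < l)%N ->
  (fun n => (n %/ l)%:R / n%:R : R) @ \oo --> (l%:R^-1 : R).
Proof.
move=> l_gt0; have cvg_invn : (fun n => (n%:R : R)^-1) @ \oo --> (0 : R).
  apply/gtr0_cvgV0; last exact: cvgr_idn.
  by near=> n; rewrite ltr0n; near: n; exact: nbhs_infty_gt.
have lower : (fun n => l%:R^-1 - (n%:R : R)^-1) @ \oo --> (l%:R^-1 : R).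
  by rewrite -[X in _ --> X]subr0; apply: cvgB cvg_invn; exact: cvg_cst.
apply: (squeeze_cvgr _ lower (cvg_cst _)); near=> n.
have n_gt0 : (0 : R) < n%:R by rewrite ltr0n; near: n; exact: nbhs_infty_gt.
have lR_gt0 : (0 : R) < l%:R by rewrite ltr0n.
have nE : n%:R = (n %/ l)%:R * l%:R + (n %% l)%:R :> R
  by rewrite -natrM -natrD -divn_eq.
have mod_lt : (n %% l)%:R < l%:R :> R by rewrite ltr_nat ltn_mod.
rewrite ler_pdivlMr// mulrBl mulVf ?gt_eqF// ler_pdivrMr// [l%:R^-1 * _]mulrC.
rewrite lerBlDr ler_pdivrMr// ler_pdivlMr// mulrDl mul1r {1 2}nE lerD2l ltW//.
by rewrite lerDl ler0n.
Unshelve. all: by end_near. Qed.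

Theorem rate_psi_plus_gt0 (A B : finType) (rho : bop A B) :
  is_state rho -> (0 < rate psi_plus rho)%E.
Proof.
move=> state_rho; have [[_ b0]] := trm1_inhabited state_rho.2.
pose l := #|B|; have l_gt0 : (0 < l)%N by apply/card_gt0P; exists b0.
suff : achievable psi_plus rho (l%:R^-1).
  move=> ach; apply: lt_le_trans (ereal_sup_ubound (imageP _ ach)).
  by rewrite lte_fin invr_gt0 ltr0n.
have [U ueb] := unitary_error_basis_qubit R.
have prep n : exists Lam : bop {ffun 'I_n -> 'I_2} {ffun 'I_n -> 'I_2} ->
      bop {ffun 'I_(n %/ l) -> A} {ffun 'I_(n %/ l) -> B},
    LOCC Lam /\ Lam (tpow psi_plus n) = tpow rho (n %/ l).
  rewrite psi_plusE tpow_maxent.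
  have [||Lam] := LOCC_state_preparation (rho := tpow rho (n %/ l))
    (unitary_error_basis_ffun 'I_n ueb); [|exact: is_state_tpow|by exists Lam].
  rewrite !card_ffun !card_ord (@leq_trans ((2 ^ l) ^ (n %/ l)))//.
    by case: (n %/ l)%N => [//|k]; rewrite leq_exp2r// ltnW// ltn_expl.
  by rewrite -expnM leq_exp2l// mulnC leq_trunc_div.
pose Lam n := sval (cid (prep n)).
have LamP n : LOCC (Lam n) /\ Lam n (tpow psi_plus n) = tpow rho (n %/ l).
  exact: svalP (cid (prep n)).
split; first by rewrite invr_ge0.
exists (fun n => (n %/ l)%N), Lam; split=> [n|]; first exact: (LamP n).1.
split; first exact: cvg_divn.
under eq_fun => n do rewrite (LamP n).2 submE subrr tnorm0.
exact: cvg_cst.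
Qed.

End Preparation.

(** * Continuity and compactness for the topology of pointwise convergence *)

Section PointwiseConvergence.

Lemma continuous_ptws (T : topologicalType) (I : Type) (V : topologicalType)
    (f : T -> {ptws I -> V}) :
  (forall i, continuous (fun t => f t i)) -> continuous f.
Proof.
move=> cf t; apply/cvg_sup => i.
move: t; apply/(@continuousP _ (initial_topology (@^~ i))) => A [B oB <-].
by apply: (@open_comp _ _ (f^~ i) B) => // t _; exact: cf.
Qed.

Lemma continuous_coord (I : eqType) (V : topologicalType) (i : I) :
  continuous (fun f : {ptws I -> V} => f i).
Proof. exact: (@proj_continuous _ (fun=> V) i). Qed.

Variable K : numFieldType.

Lemma continuous_sum (T : topologicalType) (I : Type) (s : seq I)
    (f : I -> T -> K) :
  (forall i, continuous (f i)) -> continuous (fun t => \sum_(i <- s) f i t).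
Proof. by move=> cf; apply: continuous_big => //; exact: add_continuous. Qed.

Lemma continuous_add (T : topologicalType) (f g : T -> K) :
  continuous f -> continuous g -> continuous (fun t => f t + g t).
Proof. by move=> cf cg t; exact: (cvgD (cf t) (cg t)). Qed.

Lemma continuous_sub (T : topologicalType) (f g : T -> K) :
  continuous f -> continuous g -> continuous (fun t => f t - g t).
Proof. by move=> cf cg t; exact: (cvgB (cf t) (cg t)). Qed.

Lemma continuous_mul (T : topologicalType) (f g : T -> K) :
  continuous f -> continuous g -> continuous (fun t => f t * g t).
Proof. by move=> cf cg t; exact: (cvgM (cf t) (cg t)). Qed.

Lemma continuous_sqr (T : topologicalType) (f : T -> K) :
  continuous f -> continuous (fun t => f t ^+ 2).
Proof. by move=> cf; exact: (continuous_mul cf cf). Qed.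

Lemma compact_box_level_set (R : realType) (I : eqType) (a b c : R)
    (h : {ptws I -> R} -> R) : continuous h ->
  compact [set f : {ptws I -> R} | (forall i, a <= f i <= b) /\ h f = c].
Proof.
move=> cont_h.
have -> : [set f : {ptws I -> R} | (forall i, a <= f i <= b) /\ h f = c]
    = [set f | forall i, `[a, b]%classic (f i)] `&` h @^-1` [set c].
  by apply/seteqP; split=> f /= [f_box hf]; split=> // i; have := f_box i;
    rewrite in_itv.
apply: compact_closedI; last first.
  by apply: (@preimage_closed _ _ h [set c]) => [f _|];
    [exact: cont_h|exact: closed_eq].
apply: (@tychonoff _ (fun=> R : topologicalType) (fun=> `[a, b]%classic)) => _.
exact: segment_compact.
Qed.

End PointwiseConvergence.

(** * Strict separation from the convex hull of a compact set *)

Section ConvexHulls.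
Variables (R : realType) (X : finType).
Implicit Types (S : set (X -> R)) (p q x : X -> R).

Definition convex_comb n S : set (X -> R) :=
  [set p | exists (c : 'I_n -> R) (x : 'I_n -> X -> R),
    [/\ forall k, 0 <= c k, \sum_k c k = 1, forall k, S (x k)
      & p = fun z => \sum_k c k * x k z]].

Definition convex_hull S : set (X -> R) := \bigcup_n convex_comb n S.

Lemma convex_comb_neq0 n S : S !=set0 -> convex_comb n.+1 S !=set0.
Proof.
move=> [x Sx]; exists (fun z => \sum_(k < n.+1) (ord0 == k)%:R * x z).
exists (fun k => (ord0 == k)%:R), (fun=> x); split=> //.
by under eq_bigr do rewrite -[_%:R]mulr1; rewrite sum_delta.
Qed.

Lemma convex_comb_segment n S q x t : convex_comb n S q -> S x -> 0 <= t <= 1 ->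
  convex_comb n.+1 S (fun z => (1 - t) * q z + t * x z).
Proof.
move=> [c [y [c_ge0 c1 Sy ->]]] Sx /andP[t_ge0 t_le1].
exists (fun k => if unlift ord0 k is Some j then (1 - t) * c j else t).
exists (fun k => if unlift ord0 k is Some j then y j else x); split=> [k||k|].
- by case: unliftP => // j _; rewrite mulr_ge0// subr_ge0.
- rewrite big_ord_recl unlift_none; under eq_bigr do rewrite liftK.
  by rewrite -mulr_sumr c1 mulr1 addrC subrK.
- by case: unliftP.
- apply/funext => z; rewrite big_ord_recl unlift_none.
  under [in RHS]eq_bigr do rewrite liftK -mulrA.
  by rewrite addrC mulr_sumr.
Qed.

Lemma affine_dependence n (x : 'I_n.+1 -> X -> R) : (#|X| < n)%N ->
  exists mu : 'I_n.+1 -> R, [/\ exists i, 0 < mu i, \sum_k mu k = 0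
    & forall z, \sum_k mu k * x k z = 0].
Proof.
move=> X_lt_n.
pose M := row_mx (const_mx 1) (\matrix_(k, j) x k (enum_val j)) :
  'M[R]_(_, 1 + #|X|).
have : kermx M != 0.
  by rewrite -mxrank_eq0 mxrank_ker -lt0n subn_gt0
    (leq_ltn_trans (rank_leq_col _)).
case/rowV0Pn => mu /sub_kermxP/eqP;
  rewrite mul_mx_row row_mx_eq0 => /andP[/eqP mu1 /eqP mux] mu_neq0.
have mu0 : \sum_k mu 0 k = 0.
  have /rowP/(_ 0) := mu1; rewrite !mxE => eq0; rewrite -[RHS]eq0.
  by apply: eq_bigr => k _; rewrite mxE mulr1.
exists (mu 0); split=> // [|z].
  apply: contraNP mu_neq0 => /forallNP mu_le0; apply/eqP/rowP => k; rewrite mxE.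
  have mu_ge0 i : 0 <= - mu 0 i by rewrite oppr_ge0 leNgt; apply/negP/mu_le0.
  have sumN : \sum_i - mu 0 i = 0 by rewrite sumrN mu0 oppr0.
  have /(_ k isT)/eqP := psumr_eq0P (fun i _ => mu_ge0 i) sumN.
  by rewrite oppr_eq0 => /eqP.
have /rowP/(_ (enum_rank z)) := mux; rewrite !mxE => eq0; rewrite -[RHS]eq0.
by apply: eq_bigr => k _; rewrite mxE enum_rankK.
Qed.

(* Carathéodory: move the weights along an affine dependence until one of them
   vanishes. *)
Lemma convex_comb_reduce n S :
  (#|X| < n)%N -> convex_comb n.+1 S `<=` convex_comb n S.
Proof.
move=> X_lt_n _ [c [x [c_ge0 c1 Sx ->]]].
have [mu [[i0 mu_i0] mu0 mux]] := affine_dependence x X_lt_n.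
have [i mu_i i_min] :
    exists2 i, 0 < mu i & forall k, 0 < mu k -> c i / mu i <= c k / mu k.
  pose ratio k := c k / mu k.
  by case: (arg_minP (P := fun k => 0 < mu k) ratio mu_i0) => i; exists i.
pose d k := c k - c i / mu i * mu k.
have d_ge0 k : 0 <= d k.
  rewrite subr_ge0; have [mu_k|mu_k] := ltP 0 (mu k);
    first by rewrite -ler_pdivlMr// i_min.
  by rewrite (le_trans _ (c_ge0 k))// mulr_ge0_le0// divr_ge0// ltW.
have d_i : d i = 0 by rewrite /d divfK ?subrr// gt_eqF.
have sum_d (F : 'I_n.+1 -> R) : \sum_k mu k * F k = 0 ->
    \sum_k d (lift i k) * F (lift i k) = \sum_k c k * F k.
  move=> muF; transitivity (\sum_k d k * F k).
    by rewrite [RHS](bigD1_ord i)//= d_i mul0r add0r.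
  under [LHS]eq_bigr do rewrite /d mulrBl -[_ * mu _ * _]mulrA.
  by rewrite sumrB -mulr_sumr muF mulr0 subr0.
exists (d \o lift i), (x \o lift i); split=> //=; last first.
  by apply/funext => z; rewrite -(sum_d (x^~ z)).
rewrite -c1 -[RHS](eq_bigr _ (fun k _ => mulr1 (c k))) -sum_d.
  by apply: eq_bigr => k _; rewrite mulr1.
by rewrite -[RHS]mu0; apply: eq_bigr => k _; rewrite mulr1.
Qed.

Lemma compact_simplex n :
  compact [set c : {ptws 'I_n -> R} | (forall k, 0 <= c k) /\ \sum_k c k = 1].
Proof.
pose total (c : {ptws 'I_n -> R}) := \sum_k c k.
have cont_total : continuous total.
  by apply: continuous_sum => k; exact: continuous_coord.
have := compact_box_level_set (a := 0) (b := 1) (c := 1) cont_total.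
congr compact; apply/seteqP; split=> c /= [c_ge0 c1]; split=> // k.
  by have /andP[] := c_ge0 k.
by rewrite c_ge0 -c1 (bigD1 k)//= lerDl sumr_ge0.
Qed.

Lemma compact_convex_comb n S :
  compact (S : set {ptws X -> R}) ->
  compact (convex_comb n S : set {ptws X -> R}).
Proof.
move=> compactS.
pose par := ({ptws 'I_n -> R} * {ptws 'I_n -> {ptws X -> R}})%type.
pose comb (cx : par) : {ptws X -> R} := fun z => \sum_k cx.1 k * cx.2 k z.
have cont_comb : continuous comb.
  apply: continuous_ptws => z; apply: continuous_sum => k.
  apply: continuous_mul => cx.
    apply: (cvg_comp fst (fun c : {ptws 'I_n -> R} => c k));
      first exact: cvg_fst.
    exact: continuous_coord.
  apply: (cvg_comp (fun cx : par => cx.2 k) (fun x : {ptws X -> R} => x z)).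
    apply: (cvg_comp snd (fun x : {ptws 'I_n -> {ptws X -> R}} => x k));
      first exact: cvg_snd.
    exact: continuous_coord.
  exact: continuous_coord.
have compact_pts :
    compact [set x : {ptws 'I_n -> {ptws X -> R}} | forall k, S (x k)].
  exact: (@tychonoff _ (fun=> {ptws X -> R}) (fun=> S)).
have := continuous_compact (continuous_subspaceT cont_comb)
  (compact_setX (@compact_simplex n) compact_pts).
congr compact; apply/seteqP;
  split=> [_ [[c x] [/= [c_ge0 c1] Sx] <-]|_ [c [x [c_ge0 c1 Sx ->]]]].
  by exists c, x.
by exists (c, x).
Qed.

Lemma closest_point (K : set (X -> R)) p :
  K !=set0 -> compact (K : set {ptws X -> R}) ->
  exists2 q, K q & forall q', K q' ->
    \sum_z (p z - q z) ^+ 2 <= \sum_z (p z - q' z) ^+ 2.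
Proof.
move=> K_neq0 compactK.
have cont_dist : continuous (fun q : {ptws X -> R} => \sum_z (p z - q z) ^+ 2).
  apply: continuous_sum => z; apply: continuous_sqr.
  apply: continuous_sub; [exact: cst_continuous|exact: continuous_coord].
have [q] := @compact_EVT_min {ptws X -> R} R _ K K_neq0 compactK
  (continuous_subspaceT cont_dist).
by rewrite inE => Kq q_min; exists q => // q' Kq'; apply: q_min; rewrite inE.
Qed.

Lemma le0_of_quadratic_bound (s m : R) : 0 <= m ->
  (forall t, 0 <= t <= 1 -> 2 * t * s <= t ^+ 2 * m) -> s <= 0.
Proof.
move=> m_ge0 bound; rewrite leNgt; apply/negP => s_gt0; pose t := s / (s + m).
have sm_gt0 : 0 < s + m by lra.
have t_gt0 : 0 < t by rewrite divr_gt0.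
have t_le1 : t <= 1 by rewrite ler_pdivrMr//; lra.
have tsm : t * (s + m) = s by rewrite divfK// gt_eqF.
have := bound t; rewrite (ltW t_gt0) t_le1 => /(_ isT).
rewrite -mulrA mulrCA expr2 -mulrA ler_pM2l//.
have := mulr_gt0 t_gt0 s_gt0; lra.
Qed.

Theorem strict_separation S p : S !=set0 -> compact (S : set {ptws X -> R}) ->
  ~ convex_hull S p ->
  exists (w : X -> R) (b : R),
    (forall x, S x -> \sum_z w z * x z <= b) /\ b < \sum_z w z * p z.
Proof.
move=> S_neq0 compactS pS; set N := #|X|.+1.
have [q Kq q_min] := closest_point p (convex_comb_neq0 #|X| S_neq0)
  (compact_convex_comb (n := N) compactS).
exists (fun z => p z - q z), (\sum_z (p z - q z) * q z); split=> [x Sx|].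
  rewrite -subr_le0 -sumrB; under eq_bigr do rewrite -mulrBr.
  apply: (@le0_of_quadratic_bound _ (\sum_z (x z - q z) ^+ 2)) => [|t t01].
    by rewrite sumr_ge0// => z _; exact: sqr_ge0.
  have := q_min _
      (convex_comb_reduce (leqnn _) (convex_comb_segment Kq Sx t01)).
  have -> : \sum_z (p z - ((1 - t) * q z + t * x z)) ^+ 2
      = \sum_z (p z - q z) ^+ 2
      - 2 * t * \sum_z (p z - q z) * (x z - q z)
        + t ^+ 2 * \sum_z (x z - q z) ^+ 2.
    by rewrite !mulr_sumr -sumrB -big_split; apply: eq_bigr => z _ /=; ring.
  by lra.
rewrite -subr_gt0 -sumrB; under eq_bigr do rewrite -mulrBr -expr2.
rewrite lt_neqAle sumr_ge0 ?andbT => [|z _]; last exact: sqr_ge0.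
apply: contra_notN pS => /eqP/esym pq; exists N => //; suff -> : p = q by [].
apply/funext => z; apply/eqP; rewrite -subr_eq0 -sqrf_eq0; apply/eqP.
exact: (psumr_eq0P (fun z _ => sqr_ge0 (p z - q z)) pq).
Qed.

End ConvexHulls.

(** * Informationally complete local measurements *)

Section Frames.
Variable R : realType.
Local Notation C := R[i].
Local Notation mat := (mat R).
Local Notation bop := (bop R).

Definition scalem (T U : finType) (c : C) (X : mat T U) : mat T U :=
  fun i j => c * X i j.

Lemma qform_scalem (T : finType) (X : mat T T) c w :
  qform (scalem c X) w = c * qform X w.
Proof.
rewrite !qformE mulr_sumr; apply: eq_bigr => i _; rewrite mulr_sumr.
by apply: eq_bigr => j _; rewrite /scalem; ring.
Qed.

Definition parseval_frame (X T : finType) (v : X -> T -> C) :=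
  \sum_x outer (v x) (v x) = idm T.

Definition informationally_complete (X T : finType) (v : X -> T -> C) :=
  forall M : mat T T, (forall x, qform M (v x) = 0) -> M = 0.

Lemma informationally_complete_inj (X T : finType) (v : X -> T -> C) :
  informationally_complete v ->
  forall M N, (forall x, qform M (v x) = qform N (v x)) -> M = N.
Proof.
move=> v_complete M N MN; apply/eqP; rewrite -subr_eq0; apply/eqP.
by apply: v_complete => x; rewrite qformB MN subrr.
Qed.

Definition kronf (X Y A B : finType) (v : X -> A -> C) (u : Y -> B -> C) :
  X * Y -> A * B -> C := fun z => kronv (v z.1) (u z.2).

Lemma parseval_sum_sqmod (X T : finType) (v : X -> T -> C) w :
  parseval_frame v -> \sum_x sqmod (vdot (v x) w) = sqnorm w.
Proof.
move=> v_frame; apply: complexI.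
rewrite -[RHS]qform_idm -v_frame qform_sum rmorph_sum.
by apply: eq_bigr => x _; rewrite qform_outer.
Qed.

Lemma parseval_sum_qform (X T : finType) (v : X -> T -> C) M :
  parseval_frame v -> \sum_x qform M (v x) = trm M.
Proof.
move=> v_frame; under eq_bigr do rewrite qform_trm.
by rewrite -raddf_sum -mulm_suml v_frame mul1m.
Qed.

Lemma parseval_kronf (X Y A B : finType) (v : X -> A -> C) (u : Y -> B -> C) :
  parseval_frame v -> parseval_frame u -> parseval_frame (kronf v u).
Proof.
move=> v_frame u_frame.
rewrite /parseval_frame sum_pair -kron_idm -v_frame -u_frame kron_sum.
by do 2 apply: eq_bigr => ? _; rewrite kron_outer.
Qed.

Definition block (A B : finType) (M : bop A B) (i k : A) : mat B B :=
  fun j l => M (i, j) (k, l).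

Lemma qform_kronv (A B : finType) (M : bop A B) a b :
  qform M (kronv a b) = qform (fun i k => qform (block M i k) b) a.
Proof.
rewrite !qformE sum_pair; apply: eq_bigr => i _.
under eq_bigr do rewrite sum_pair.
rewrite exchange_big; apply: eq_bigr => k _ /=.
rewrite qformE mulr_sumr mulr_suml.
apply: eq_bigr => j _; rewrite mulr_sumr mulr_suml; apply: eq_bigr => l _.
by rewrite /kronv /block rmorphM /=; ring.
Qed.

Lemma informationally_complete_kronf (X Y A B : finType) (v : X -> A -> C)
    (u : Y -> B -> C) :
  informationally_complete v -> informationally_complete u ->
  informationally_complete (kronf v u).
Proof.
move=> v_complete u_complete M M0; apply: matP => -[i j] [k l].
suff block0 : block M i k = 0.
  by have := congr1 (fun N : mat B B => N j l) block0.
apply: u_complete => y.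
have qform_block0 : (fun i k => qform (block M i k) (u y)) = 0 :> mat A A.
  by apply: v_complete => x; rewrite -qform_kronv; exact: (M0 (x, y)).
by have := congr1 (fun N : mat A A => N i k) qform_block0.
Qed.

Definition polar_vec (T : finType) (x : T * T * 'I_4) : T -> C :=
  scalev (Num.sqrt (8 * #|T|)%:R^-1)%:C
    (basisv x.1.1 + scalev ('i ^+ x.2) (basisv x.1.2)).

Lemma vdot_polar_vec (T : finType) (x : T * T * 'I_4) w :
  vdot (polar_vec x) w
  = (Num.sqrt (8 * #|T|)%:R^-1)%:C * (w x.1.1 + (- 'i) ^+ x.2 * w x.1.2).
Proof. by rewrite vdotZl conjc_real vdotDl vdotZl !vdot_basisl conjc_iX. Qed.

Lemma sum_sqmod_phase (z z' : C) :
  \sum_(s < 4) sqmod (z + (- 'i) ^+ s * z') = 4 * (sqmod z + sqmod z').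
Proof.
have sqmodE s : (sqmod (z + (- 'i) ^+ s * z'))%:C
    = (z + (- 'i) ^+ s * z') * (conjc z + 'i ^+ s * conjc z').
  by rewrite -mulcJ rmorphD rmorphM /= -conjc_iX conjcK.
have i_sqr : 'i * 'i = -1 :> C by rewrite -expr2 sqr_i.
apply: complexI; rewrite rmorph_sum.
under eq_bigr do rewrite /= sqmodE.
transitivity (4 * (z * conjc z + z' * conjc z')); last first.
  by rewrite !mulcJ -rmorphD rmorphM rmorph_nat.
rewrite !big_ord_recr big_ord0 /= !(exprS, expr0) !mulr1.
by move: ('i : C) i_sqr => i i_sqr; ring: i_sqr.
Qed.

Lemma parseval_polar_vec (T : finType) : parseval_frame (@polar_vec T).
Proof.
apply: qform_inj => w; rewrite qform_sum qform_idm.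
have pairE p q :
    \sum_(s < 4) qform (outer (polar_vec (p, q, s)) (polar_vec (p, q, s))) w
    = ((8 * #|T|)%:R^-1 * (4 * (sqmod (w p) + sqmod (w q))))%:C.
  rewrite -sum_sqmod_phase mulr_sumr rmorph_sum; apply: eq_bigr => s _.
  by rewrite qform_outer vdot_polar_vec sqmodM sqmod_real sqr_sqrtr ?invr_ge0.
rewrite !sum_pair; under eq_bigr do under eq_bigr do rewrite pairE.
under eq_bigr do rewrite -rmorph_sum -mulr_sumr -mulr_sumr big_split
  sumr_const /=.
rewrite -rmorph_sum -!mulr_sumr big_split sumr_const sumrMnl /= -!/(sqnorm _)
  -mulrnDl.
have [T0|T_gt0] := posnP #|T|.
  by rewrite [sqnorm w]big1 ?addr0 ?mul0rn ?mulr0// => t; have := fintype0 t;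
    rewrite T0 => /(_ erefl).
have T_neq0 : #|T|%:R != 0 :> R by rewrite pnatr_eq0 -lt0n.
by congr (_%:C); rewrite -mulr_natr natrM; field.
Qed.

Lemma polar_vec_complete (T : finType) :
  informationally_complete (@polar_vec T).
Proof.
move=> M M0; apply: qform_basis_phase_eq0 => p q s.
have T_gt0 : (0 < #|T|)%N by apply/card_gt0P; exists p.
have := M0 (p, q, s); rewrite qformZ sqmod_real sqr_sqrtr ?invr_ge0// => /eqP.
by rewrite mulf_eq0 fmorph_eq0 invr_eq0 pnatr_eq0 muln_eq0 -[#|T| == 0%N]negbK
  -lt0n T_gt0 => /eqP.
Qed.

End Frames.

(** * Outcome distributions of product vectors *)

Section ProductDistributions.
Variable R : realType.
Local Notation C := R[i].

Section Spheres.
Variable T : finType.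

Definition cvec (f : {ptws T * bool -> R}) : T -> C :=
  fun t => Complex (f (t, true)) (f (t, false)).

Lemma cvec_surj (w : T -> C) : exists f, w = cvec f.
Proof.
exists (fun tb => if tb.2 then Re (w tb.1) else Im (w tb.1)).
by apply/funext => t; rewrite /cvec; case: (w t).
Qed.

Lemma sqnorm_cvec f : sqnorm (cvec f) = \sum_j f j ^+ 2.
Proof. by rewrite sum_pair; apply: eq_bigr => t _; rewrite big_bool. Qed.

Lemma continuous_linear_form (J : finType) (k : J -> R) :
  continuous (fun f : {ptws J -> R} => \sum_j k j * f j).
Proof.
apply: continuous_sum => j; apply: continuous_mul; last exact: continuous_coord.
exact: cst_continuous.
Qed.

Lemma continuous_sqmod_vdot (w : T -> C) :
  continuous (fun f => sqmod (vdot w (cvec f))).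
Proof.
pose re j := if j.2 then Re (w j.1) else Im (w j.1).
pose im j := if j.2 then - Im (w j.1) else Re (w j.1).
have -> : (fun f => sqmod (vdot w (cvec f)))
    = fun f => (\sum_j re j * f j) ^+ 2 + (\sum_j im j * f j) ^+ 2.
  apply/funext => f; rewrite /sqmod !raddf_sum !sum_pair.
  congr (_ ^+ 2 + _ ^+ 2); apply: eq_bigr => t _;
    rewrite big_bool /re /im /cvec /=;
    by case: (w t) => a b /=; ring.
by apply: continuous_add; apply: continuous_sqr; exact: continuous_linear_form.
Qed.

Lemma compact_sphere : compact [set f | sqnorm (cvec f) = 1].
Proof.
have cont_sqnorm : continuous (fun f : {ptws T * bool -> R} => \sum_j f j ^+ 2).
  by apply: continuous_sum => j; apply: continuous_sqr; exact: continuous_coord.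
have := compact_box_level_set (a := -1) (b := 1) (c := 1) cont_sqnorm.
congr compact; apply/seteqP; split=> f /=; rewrite sqnorm_cvec; first by case.
move=> f1; split=> // j.
rewrite -ler_norml -(@expr_le1 _ 2)// real_normK ?num_real// -f1.
by rewrite (bigD1 j)//= lerDl sumr_ge0// => i _; exact: sqr_ge0.
Qed.

End Spheres.

Definition born_prob (X T : finType) (v : X -> T -> C) (w : T -> C) (x : X)
  : R := sqmod (vdot (v x) w).

Definition unit_product_probs (X Y A B : finType) (v : X -> A -> C)
    (u : Y -> B -> C) : set (X * Y -> R) :=
  [set p | exists a b,
    [/\ sqnorm a = 1, sqnorm b = 1 & p = born_prob (kronf v u) (kronv a b)]].

Lemma born_prob_ge0 (X T : finType) (v : X -> T -> C) w x :
  0 <= born_prob v w x.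
Proof. exact: sqmod_ge0. Qed.

Lemma born_probZ (X T : finType) (v : X -> T -> C) c w x :
  born_prob v (scalev c w) x = sqmod c * born_prob v w x.
Proof. by rewrite /born_prob vdotZr sqmodM. Qed.

Lemma born_prob_kron (X Y A B : finType) (v : X -> A -> C)
    (u : Y -> B -> C) a b z :
  born_prob (kronf v u) (kronv a b) z = born_prob v a z.1 * born_prob u b z.2.
Proof. by rewrite /born_prob vdot_kronv sqmodM. Qed.

Lemma born_prob_kronZ (X Y A B : finType) (v : X -> A -> C)
    (u : Y -> B -> C) r s a b z :
  born_prob (kronf v u) (kronv (scalev r a) (scalev s b)) z
  = sqmod r * sqmod s * born_prob (kronf v u) (kronv a b) z.
Proof. by rewrite !born_prob_kron !born_probZ mulrACA. Qed.

Lemma compact_unit_product_probs (X Y A B : finType) (v : X -> A -> C)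
    (u : Y -> B -> C) :
  compact (unit_product_probs v u : set {ptws X * Y -> R}).
Proof.
pose par := ({ptws A * bool -> R} * {ptws B * bool -> R})%type.
pose probs (fg : par) : {ptws X * Y -> R} :=
  born_prob (kronf v u) (kronv (cvec fg.1) (cvec fg.2)).
have cont_probs : continuous probs.
  apply: continuous_ptws => z.
  have -> : (fun fg => probs fg z)
      = fun fg => born_prob v (cvec fg.1) z.1 * born_prob u (cvec fg.2) z.2.
    by apply/funext => fg; exact: born_prob_kron.
  apply: continuous_mul => fg.
    apply: (cvg_comp fst (fun f => born_prob v (cvec f) z.1));
      first exact: cvg_fst.
    exact: continuous_sqmod_vdot.
  apply: (cvg_comp snd (fun g => born_prob u (cvec g) z.2));
    first exact: cvg_snd.
  exact: continuous_sqmod_vdot.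
have := continuous_compact (continuous_subspaceT cont_probs)
  (compact_setX (@compact_sphere A) (@compact_sphere B)).
congr compact; apply/seteqP;
  split=> [_ [[f g] /= [f1 g1] <-]|_ [a [b [a1 b1 ->]]]].
  by exists (cvec f), (cvec g).
have [f af] := cvec_surj a; have [g bg] := cvec_surj b.
by exists (f, g); rewrite /= -?af -?bg // /probs -af -bg.
Qed.

End ProductDistributions.

(** * Separating an entangled state from product vectors *)

Section Witness.
Variable R : realType.
Local Notation C := R[i].
Local Notation mat := (mat R).
Local Notation bop := (bop R).

Definition outcome_prob (X T : finType) (v : X -> T -> C) (M : mat T T)
    (x : X) : R := Re (qform M (v x)).

Lemma outcome_prob_outer (X T : finType) (v : X -> T -> C) w x :
  outcome_prob v (outer w w) x = born_prob v w x.
Proof. by rewrite /outcome_prob qform_outer sqmod_vdotC. Qed.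

Lemma outcome_prob_sum (X T : finType) (v : X -> T -> C) (I : Type)
    (s : seq I) (M : I -> mat T T) x :
  outcome_prob v (\sum_(k <- s) M k) x = \sum_(k <- s) outcome_prob v (M k) x.
Proof. by rewrite /outcome_prob qform_sum raddf_sum. Qed.

Lemma outcome_prob_ge0 (X T : finType) (v : X -> T -> C) M x :
  psd M -> 0 <= outcome_prob v M x.
Proof. by move=> psdM; rewrite -ler0c -psd_qform_real//; exact: (psdP M).1. Qed.

Lemma sum_outcome_prob (X T : finType) (v : X -> T -> C) M :
  parseval_frame v -> trm M = 1 -> \sum_x outcome_prob v M x = 1.
Proof.
by move=> v_frame M1; rewrite /outcome_prob -raddf_sum parseval_sum_qform// M1.
Qed.

Lemma sum_born_prob_product (X Y A B : finType) (v : X -> A -> C)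
    (u : Y -> B -> C) a b :
  parseval_frame v -> parseval_frame u ->
  \sum_z born_prob (kronf v u) (kronv a b) z = sqnorm a * sqnorm b.
Proof.
move=> v_frame u_frame; rewrite -sqnorm_kronv.
by rewrite -(parseval_sum_sqmod _ (parseval_kronf v_frame u_frame)).
Qed.

Lemma separable_of_hull (X Y A B : finType) (v : X -> A -> C) (u : Y -> B -> C)
    (rho : bop A B) :
  informationally_complete (kronf v u) -> psd rho ->
  convex_hull (unit_product_probs v u) (outcome_prob (kronf v u) rho) ->
  separable rho.
Proof.
move=> vu_complete psd_rho [n _ [c [p [c_ge0 c1 prod_p rhoE]]]].
have /choice[ab abP] k : exists ab : (A -> C) * (B -> C),
    [/\ sqnorm ab.1 = 1, sqnorm ab.2 = 1
    & p k = born_prob (kronf v u) (kronv ab.1 ab.2)].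
  by have [a [b [a1 b1 pE]]] := prod_p k; exists (a, b).
pose alpha k := outer (ab k).1 (ab k).1; pose beta k := outer (ab k).2 (ab k).2.
exists n, c, alpha, beta; split=> //; split=> //; split=> [k|x y].
  by have [a1 b1 _] := abP k; split; exact: is_state_outer.
suff -> : rho = \sum_k scalem (c k)%:C (kron (alpha k) (beta k))
  by rewrite mat_sumE.
apply: (informationally_complete_inj vu_complete) => z.
rewrite psd_qform_real// -/(outcome_prob _ _ _) rhoE qform_sum rmorph_sum.
apply: eq_bigr => k _.
rewrite qform_scalem kron_outer qform_outer sqmod_vdotC rmorphM.
by have [_ _ ->] := abP k.
Qed.

Lemma unit_vector_scale (T : finType) (t0 : T) (w : T -> C) :
  exists (r : R) (a : T -> C), sqnorm a = 1 /\ w = scalev r%:C a.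
Proof.
have [w0|w_neq0] := eqVneq (sqnorm w) 0.
  exists 0, (basisv t0); split; first exact: sqnorm_basis.
  apply/funext => t; rewrite /scalev mul0r; apply/eqP.
  rewrite -sqmod_eq0; apply/eqP.
  exact: (psumr_eq0P (fun t _ => sqmod_ge0 (w t)) w0).
have w_gt0 : 0 < sqnorm w by rewrite lt_neqAle eq_sym w_neq0 sqnorm_ge0.
pose r := Num.sqrt (sqnorm w).
have r_neq0 : r != 0 by rewrite gt_eqF// sqrtr_gt0.
exists r, (scalev (r^-1)%:C w); split.
  by rewrite sqnormZ sqmod_real exprVn sqr_sqrtr ?sqnorm_ge0// mulVf.
by apply/funext => t; rewrite /scalev mulrA -rmorphM mulfV// rmorph1 mul1r.
Qed.

Lemma entangled_witness (X Y A B : finType) (v : X -> A -> C) (u : Y -> B -> C)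
    (rho : bop A B) :
  parseval_frame v -> parseval_frame u ->
  informationally_complete (kronf v u) ->
  entangled rho ->
  exists w : X * Y -> R,
    (forall a b, \sum_z w z * born_prob (kronf v u) (kronv a b) z <= 0) /\
    0 < \sum_z w z * outcome_prob (kronf v u) rho z.
Proof.
move=> v_frame u_frame vu_complete [[psd_rho rho1] nsep].
have [[a0 b0]] := trm1_inhabited rho1.
have [||w [beta [w_le w_gt]]] :=
  strict_separation (p := outcome_prob (kronf v u) rho) _
    (@compact_unit_product_probs _ _ _ _ _ v u).
- exists (born_prob (kronf v u) (kronv (basisv a0) (basisv b0))).
  by exists (basisv a0), (basisv b0); rewrite !sqnorm_basis.
- by apply: contra_not nsep; exact: separable_of_hull.
have shift (p : X * Y -> R) : \sum_z p z = 1 ->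
    \sum_z (w z - beta) * p z = \sum_z w z * p z - beta.
  by move=> p1; under eq_bigr do rewrite mulrBl;
    rewrite sumrB -mulr_sumr p1 mulr1.
exists (fun z => w z - beta); split=> [a b|]; last first.
  by rewrite shift ?subr_gt0// sum_outcome_prob//; exact: parseval_kronf.
have [r [a' [norm_a ->]]] := unit_vector_scale a0 a.
have [s [b' [norm_b ->]]] := unit_vector_scale b0 b.
under eq_bigr do rewrite born_prob_kronZ mulrCA.
rewrite -mulr_sumr mulr_ge0_le0 ?mulr_ge0 ?sqmod_ge0// shift ?subr_le0.
  by apply: w_le; exists a', b'.
by rewrite sum_born_prob_product// norm_a norm_b mulr1.
Qed.

Definition product_bounded (X Y A B : finType) (v : X -> A -> C)
    (u : Y -> B -> C) (g : X * Y -> R) :=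
  forall a b,
    \sum_z g z * born_prob (kronf v u) (kronv a b) z <= sqnorm a * sqnorm b.

Definition tilted_mass (X T : finType) (v : X -> T -> C) (M : mat T T)
    (g : X -> R) : R := \sum_x outcome_prob v M x / g x.

Lemma invr1D_le (y : R) : `|y| <= 2^-1 -> (1 + y)^-1 <= 1 - y + 2 * y ^+ 2.
Proof.
rewrite ler_norml => /andP[y_ge y_le]; have y1_gt0 : 0 < 1 + y by lra.
rewrite -[leLHS]mul1r ler_pdivrMr//; have := sqr_ge0 y; nra.
Qed.

Lemma small_tilt (Z : finType) (p w : Z -> R) :
  (forall z, 0 <= p z) -> \sum_z p z = 1 -> 0 < \sum_z w z * p z ->
  exists e,
    [/\ 0 < e, forall z, 0 < 1 + e * w z & \sum_z p z / (1 + e * w z) < 1].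
Proof.
move=> p_ge0 p1; set d := \sum_z _ => d_gt0.
pose W := 1 + \sum_z `|w z|; have W_ge1 : 1 <= W by rewrite lerDl sumr_ge0.
have w_le z : `|w z| <= W.
  by rewrite /W (bigD1 z)//= addrCA lerDl addr_ge0// sumr_ge0.
have d_le : d <= W.
  rewrite -[W]mulr1 -p1 mulr_sumr; apply: ler_sum => z _.
  by rewrite ler_wpM2r// (le_trans (ler_norm _)).
have W_gt0 : 0 < W by lra.
pose e := d / (4 * W ^+ 2).
have e_gt0 : 0 < e by rewrite divr_gt0// mulr_gt0// exprn_gt0.
have eW : e * W ^+ 2 = d / 4 by rewrite /e; field; rewrite gt_eqF.
have eW_le : e * W <= 4^-1.
  by rewrite -(ler_pM2r W_gt0) -mulrA -expr2 eW; lra.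
have eW_ge0 : 0 <= e * W by apply: mulr_ge0; exact: ltW.
have ew_le z : `|e * w z| <= 2^-1.
  by rewrite normrM gtr0_norm// (le_trans (ler_wpM2l (ltW e_gt0) (w_le z)))//;
    lra.
exists e; split=> // [z|].
  by have := ew_le z; rewrite ler_norml => /andP[]; lra.
apply: (@le_lt_trans _ _
  (\sum_z (p z - e * (w z * p z) + 2 * (e * W) ^+ 2 * p z))).
  apply: ler_sum => z _.
  have -> : p z - e * (w z * p z) + 2 * (e * W) ^+ 2 * p z
    = p z * (1 - e * w z + 2 * (e * W) ^+ 2) by ring.
  rewrite ler_wpM2l// (le_trans (invr1D_le (ew_le z)))// lerD2l ler_pM2l//.
  rewrite -[leLHS]real_normK ?num_real// lerXn2r ?nnegrE//.
  by rewrite normrM gtr0_norm// ler_pM2l.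
have eW2 : (e * W) ^+ 2 = e * (d / 4) by rewrite -eW; ring.
rewrite big_split sumrB /= -!mulr_sumr p1 -/d mulr1 eW2.
by have := mulr_gt0 e_gt0 d_gt0; lra.
Qed.

Theorem entangled_tilt (A B : finType) (rho : bop A B) : entangled rho ->
  exists (X Y : finType) (v : X -> A -> C) (u : Y -> B -> C) (g : X * Y -> R),
    [/\ parseval_frame v, parseval_frame u, forall z, 0 < g z,
      product_bounded v u g & tilted_mass (kronf v u) rho g < 1].
Proof.
move=> ent_rho; have [[psd_rho rho1] _] := ent_rho.
have v_frame := @parseval_polar_vec R A.
have u_frame := @parseval_polar_vec R B.
have vu_complete := informationally_complete_kronf (@polar_vec_complete R A)
  (@polar_vec_complete R B).
have [w [w_le w_gt]] := entangled_witness v_frame u_frame vu_complete ent_rho.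
have [|e [e_gt0 g_gt0 tilt_lt1]] :=
  small_tilt _ (sum_outcome_prob (parseval_kronf v_frame u_frame) rho1) w_gt.
  by move=> z; exact: outcome_prob_ge0.
exists _, _, (@polar_vec R A), (@polar_vec R B), (fun z => 1 + e * w z).
split=> // a b.
under eq_bigr do rewrite mulrDl mul1r -mulrA.
by rewrite big_split /= sum_born_prob_product// -mulr_sumr gerDl pmulr_rle0.
Qed.

End Witness.

(** * Tensor powers of product-bounded weights *)

Section FiniteFunctions.
Variables (T : finType) (m : nat).

Definition fcons (p : T * {ffun 'I_m -> T}) : {ffun 'I_m.+1 -> T} :=
  [ffun i => oapp p.2 p.1 (unlift ord0 i)].

Lemma fcons0 p : fcons p ord0 = p.1.
Proof. by rewrite ffunE unlift_none. Qed.

Lemma fconsS p i : fcons p (lift ord0 i) = p.2 i.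
Proof. by rewrite ffunE liftK. Qed.

Lemma fcons_bij : bijective fcons.
Proof.
pose uncons (f : {ffun 'I_m.+1 -> T}) :=
  (f ord0, [ffun i : 'I_m => f (lift ord0 i)]).
exists uncons => [[t f]|f]; rewrite /uncons.
  by rewrite fcons0; congr (_, _); apply/ffunP => i; rewrite ffunE fconsS.
apply/ffunP => i; case: (unliftP ord0 i) => [j|] ->;
  first by rewrite fconsS ffunE.
by rewrite fcons0.
Qed.

End FiniteFunctions.

Section Tensor.
Variable R : realType.
Local Notation C := R[i].

Definition slice (A A' : finType) (w : A * A' -> C) (a' : A') : A -> C :=
  fun a => w (a, a').

Definition partial_vdot (A A' : finType) (v : A -> C) (w : A * A' -> C)
  : A' -> C := fun a' => vdot v (slice w a').

Lemma vdot_kronv_partial (A A' : finType) (v : A -> C) (v' : A' -> C) w :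
  vdot (kronv v v') w = vdot v' (partial_vdot v w).
Proof.
rewrite /vdot sum_pair exchange_big; apply: eq_bigr => a' _; rewrite mulr_sumr.
by apply: eq_bigr => a _; rewrite /kronv /slice rmorphM /=; ring.
Qed.

Lemma sqnorm_slices (A A' : finType) (w : A * A' -> C) :
  sqnorm w = \sum_a' sqnorm (slice w a').
Proof. by rewrite /sqnorm sum_pair exchange_big. Qed.

(* Measuring one factor of a product vector leaves a product vector, so the
   factors can be contracted one after the other. *)
Lemma product_bounded_kronf (X Y A B X' Y' A' B' : finType)
    (v : X -> A -> C) (u : Y -> B -> C) (g : X * Y -> R)
    (v' : X' -> A' -> C) (u' : Y' -> B' -> C) (g' : X' * Y' -> R) :
  (forall z, 0 <= g z) -> product_bounded v u g -> product_bounded v' u' g' ->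
  product_bounded (kronf v v') (kronf u u')
    (fun z => g (z.1.1, z.2.1) * g' (z.1.2, z.2.2)).
Proof.
move=> g_ge0 g_bounded g'_bounded a b.
pose pa x := partial_vdot (v x) a; pose pb y := partial_vdot (u y) b.
have -> : \sum_z g (z.1.1, z.2.1) * g' (z.1.2, z.2.2)
      * born_prob (kronf (kronf v v') (kronf u u')) (kronv a b) z
    = \sum_x \sum_y g (x, y) *
      \sum_z g' z * born_prob (kronf v' u') (kronv (pa x) (pb y)) z.
  rewrite !sum_pair; apply: eq_bigr => x _; rewrite exchange_big sum_pair.
  apply: eq_bigr => y _; rewrite exchange_big mulr_sumr sum_pair.
  apply: eq_bigr => x' _.
  apply: eq_bigr => y' _ /=; rewrite -mulrA !born_prob_kron.
  congr (_ * (_ * (_ * _))).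
    by rewrite /born_prob vdot_kronv_partial.
  by rewrite /born_prob vdot_kronv_partial.
apply: (@le_trans _ _
  (\sum_x \sum_y g (x, y) * (sqnorm (pa x) * sqnorm (pb y)))).
  by apply: ler_sum => x _; apply: ler_sum => y _;
    rewrite ler_wpM2l// g'_bounded.
have -> : \sum_x \sum_y g (x, y) * (sqnorm (pa x) * sqnorm (pb y))
    = \sum_a' \sum_b' \sum_z g z *
      born_prob (kronf v u) (kronv (slice a a') (slice b b')) z.
  under [RHS]eq_bigr do rewrite exchange_big.
  rewrite [RHS]exchange_big sum_pair; apply: eq_bigr => x _.
  apply: eq_bigr => y _.
  rewrite mulr_suml mulr_sumr; apply: eq_bigr => a' _; rewrite !mulr_sumr.
  by apply: eq_bigr => b' _; rewrite born_prob_kron.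
rewrite [sqnorm a]sqnorm_slices [sqnorm b]sqnorm_slices mulr_suml.
apply: ler_sum => a' _.
by rewrite mulr_sumr; apply: ler_sum => b' _.
Qed.

Definition vpow (m : nat) (X A : finType) (v : X -> A -> C) :
  {ffun 'I_m -> X} -> {ffun 'I_m -> A} -> C := fun x a => \prod_k v (x k) (a k).

Definition weight_pow (m : nat) (X Y : finType) (g : X * Y -> R)
  (z : {ffun 'I_m -> X} * {ffun 'I_m -> Y}) : R := \prod_k g (z.1 k, z.2 k).

Lemma parseval_vpow m (X A : finType) (v : X -> A -> C) :
  parseval_frame v -> parseval_frame (@vpow m X A v).
Proof.
move=> v_frame; apply: matP => a a'; rewrite mat_sumE /outer /vpow.
under eq_bigr do rewrite rmorph_prod -big_split /=.
rewrite -(bigA_distr_bigA (fun k x => v x (a k) * conjc (v x (a' k)))) /idm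
  natr_eq_ffun.
by apply: eq_bigr => k _; rewrite -[RHS]/(idm A (a k) (a' k)) -v_frame mat_sumE.
Qed.

Lemma vdot_vpowS m (X A : finType) (v : X -> A -> C) p a :
  vdot (vpow v (@fcons X m p)) a = vdot (kronf v (vpow v) p) (a \o @fcons A m).
Proof.
rewrite /vdot (reindex _ (onW_bij _ (fcons_bij A m))); apply: eq_bigr => q _ /=.
congr (conjc _ * _); rewrite /vpow big_ord_recl !fcons0.
by congr (_ * _); apply: eq_bigr => k _; rewrite !fconsS.
Qed.

Lemma sqnorm_fcons m (A : finType) (a : {ffun 'I_m.+1 -> A} -> C) :
  sqnorm (a \o @fcons A m) = sqnorm a.
Proof. by rewrite /sqnorm [RHS](reindex _ (onW_bij _ (fcons_bij A m))). Qed.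

Lemma product_bounded_vpow m (X Y A B : finType) (v : X -> A -> C)
    (u : Y -> B -> C) (g : X * Y -> R) :
  parseval_frame v -> parseval_frame u -> (forall z, 0 <= g z) ->
  product_bounded v u g ->
  product_bounded (@vpow m X A v) (@vpow m Y B u) (@weight_pow m X Y g).
Proof.
move=> v_frame u_frame g_ge0 g_bounded; elim: m => [|m IH] a b.
  rewrite -(sum_born_prob_product a b (parseval_vpow 0 v_frame)
    (parseval_vpow 0 u_frame)).
  by apply: ler_sum => z _; rewrite /weight_pow big_ord0 mul1r.
rewrite -(sqnorm_fcons a) -(sqnorm_fcons b).
have split_head : \sum_z weight_pow g z
      * born_prob (kronf (vpow v) (vpow u)) (kronv a b) z
    = \sum_z g (z.1.1, z.2.1) * weight_pow g (z.1.2, z.2.2)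
      * born_prob (kronf (kronf v (vpow v)) (kronf u (vpow u)))
        (kronv (a \o @fcons A m) (b \o @fcons B m)) z.
  rewrite sum_pair [RHS]sum_pair (reindex _ (onW_bij _ (fcons_bij X m))).
  apply: eq_bigr => x _; rewrite (reindex _ (onW_bij _ (fcons_bij Y m))).
  apply: eq_bigr => y _ /=.
  rewrite !born_prob_kron /born_prob /= !vdot_vpowS; congr (_ * _).
  rewrite /weight_pow big_ord_recl /= !fcons0; congr (_ * _).
  by apply: eq_bigr => k _; rewrite !fconsS.
by rewrite split_head; exact: (product_bounded_kronf g_ge0 g_bounded IH).
Qed.

End Tensor.

(** * Positivity of the entanglement cost *)

Section HypothesisTest.
Variable R : realType.
Local Notation C := R[i].
Local Notation mat := (mat R).
Local Notation bop := (bop R).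

Lemma markov_sum (Z : finType) (P : pred Z) (f p : Z -> R) :
  (forall z, P z -> 1 <= f z) -> (forall z, 0 <= f z) -> (forall z, 0 <= p z) ->
  \sum_(z | P z) p z <= \sum_z f z * p z.
Proof.
move=> f_ge1 f_ge0 p_ge0; rewrite [leRHS](bigID P)/= -[leLHS]addr0 lerD//.
  by apply: ler_sum => z Pz; rewrite ler_peMl// f_ge1.
by apply: sumr_ge0 => z _; rewrite mulr_ge0.
Qed.

Lemma normr_sum_outcome_prob_le_tnorm (T Z : finType) (v : Z -> T -> C)
    (P : pred Z) (M : mat T T) :
  parseval_frame v -> hermitian M ->
  `|\sum_(z | P z) outcome_prob v M z| <= tnorm M.
Proof.
move=> v_frame hermM; pose E := \sum_(z | P z) outer (v z) (v z).
have -> : \sum_(z | P z) outcome_prob v M z = Re (trm (mulm E M)).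
  rewrite /E mulm_suml (raddf_sum trm) raddf_sum; apply: eq_bigr => z _.
  by rewrite -[RHS]/(Re (trm (mulm (outer (v z) (v z)) M))) -qform_trm.
apply: le_trans (Re_le_normc _) _; apply: normc_trm_le_tnorm => // w.
have -> : qform E w = (\sum_(z | P z) sqmod (vdot (v z) w))%:C.
  by rewrite qform_sum rmorph_sum; apply: eq_bigr => z _; rewrite qform_outer.
rewrite normc_real ger0_norm; last by apply: sumr_ge0 => z _; exact: sqmod_ge0.
rewrite -(parseval_sum_sqmod w v_frame) [leRHS](bigID P)/= lerDl.
by apply: sumr_ge0 => z _; exact: sqmod_ge0.
Qed.

Lemma qform_tpow (A B X Y : finType) (v : X -> A -> C) (u : Y -> B -> C)
    (rho : bop A B) m z :
  qform (tpow rho m) (kronf (vpow v) (vpow u) z)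
  = \prod_(k < m) qform rho (kronf v u (z.1 k, z.2 k)).
Proof.
under [RHS]eq_bigr do rewrite qformE.
rewrite qformE prod_sum_pair; apply: eq_bigr => i _.
rewrite prod_sum_pair; apply: eq_bigr => j _.
rewrite !big_split /= -rmorph_prod.
by rewrite /kronf /kronv /vpow !big_split.
Qed.

Lemma outcome_prob_tpow (A B X Y : finType) (v : X -> A -> C) (u : Y -> B -> C)
    (rho : bop A B) m z : psd rho ->
  outcome_prob (kronf (vpow v) (vpow u)) (tpow rho m) z
  = weight_pow (outcome_prob (kronf v u) rho) z.
Proof.
move=> psd_rho; rewrite /outcome_prob qform_tpow.
suff -> : \prod_(k < m) qform rho (kronf v u (z.1 k, z.2 k))
    = (weight_pow (outcome_prob (kronf v u) rho) z)%:C by [].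
by rewrite rmorph_prod; apply: eq_bigr => k _; exact: psd_qform_real.
Qed.

(* Cauchy-Schwarz over the [#|D|] Schmidt terms cancels the normalisation. *)
Lemma born_prob_kron_maxent_vec (Z A B D : finType) (v : Z -> A * B -> C)
    (K : mat A D) (L : mat B D) z :
  born_prob v (appm (kron K L) (@maxent_vec R D)) z
  <= \sum_i born_prob v (kronv (K^~ i) (L^~ i)) z.
Proof.
rewrite appm_kron_maxent_vec born_probZ sqmod_real sqr_sqrtr ?invr_ge0//.
rewrite /born_prob vdot_sumr; have [D0|D_gt0] := posnP #|D|.
  by rewrite D0 invr0 mul0r sumr_ge0// => i _; exact: sqmod_ge0.
by rewrite ler_pdivrMl ?ltr0n// sqmod_sum_le.
Qed.

Lemma LOCC_maxent_test_le (A B D X Y : finType) (v : X -> A -> C)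
    (u : Y -> B -> C) (P : pred (X * Y)) (c : R) (Lam : bop D D -> bop A B) :
  LOCC Lam ->
  (forall a b,
    \sum_(z | P z) born_prob (kronf v u) (kronv a b) z
    <= c * (sqnorm a * sqnorm b)) ->
  \sum_(z | P z) outcome_prob (kronf v u) (Lam (maxent D)) z <= c * #|D|%:R.
Proof.
move=> /LOCC_separable[s -> tp_s] test_le.
apply: (@le_trans _ _ (\sum_(z | P z) \sum_(p <- s) \sum_i
    born_prob (kronf v u) (kronv (p.1^~ i) (p.2^~ i)) z)).
  apply: ler_sum => z _; rewrite outcome_prob_sum; apply: ler_sum => p _.
  by rewrite sandw_outer outcome_prob_outer born_prob_kron_maxent_vec.
rewrite exchange_big /=.
apply: (@le_trans _ _
  (\sum_(p <- s) \sum_i c * (sqnorm (p.1^~ i) * sqnorm (p.2^~ i)))).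
  by apply: ler_sum => p _; rewrite exchange_big; apply: ler_sum => i _;
    exact: test_le.
under eq_bigr do rewrite -mulr_sumr.
rewrite -mulr_sumr exchange_big /=.
suff -> : \sum_i \sum_(p <- s) sqnorm (p.1^~ i) * sqnorm (p.2^~ i) = #|D|%:R.
  by [].
rewrite -sum1_card natr_sum; apply: eq_bigr => i _.
rewrite -(sqnorm_basis R (i, i)) -(sum_sqnorm_appm _ tp_s).
apply: eq_bigr => p _.
by rewrite -kronv_basis appm_kron !appm_basis sqnorm_kronv.
Qed.

Section Test.
Variables (A B X Y : finType) (v : X -> A -> C) (u : Y -> B -> C)
  (g : X * Y -> R).
Variables (rho : bop A B) (t : R) (m : nat).
Hypotheses (v_frame : parseval_frame v) (u_frame : parseval_frame u).
Hypotheses (g_gt0 : forall z, 0 < g z) (g_bounded : product_bounded v u g).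
Hypotheses (state_rho : is_state rho) (t_gt0 : 0 < t).

Definition accepts (z : {ffun 'I_m -> X} * {ffun 'I_m -> Y}) : bool :=
  t ^+ m <= weight_pow g z.

Lemma weight_pow_gt0 z : 0 < @weight_pow R m X Y g z.
Proof. exact: prodr_gt0. Qed.

Lemma product_accept_le a b :
  \sum_(z | accepts z) born_prob (kronf (vpow v) (vpow u)) (kronv a b) z
  <= t ^- m * (sqnorm a * sqnorm b).
Proof.
have tm_gt0 : 0 < t ^+ m by rewrite exprn_gt0.
have bounded := product_bounded_vpow (m := m) v_frame u_frame
  (fun z => ltW (g_gt0 z)) g_bounded.
apply: le_trans (ler_wpM2l _ (bounded a b)); last by rewrite invr_ge0 ltW.
rewrite mulr_sumr; under [leRHS]eq_bigr do rewrite mulrA.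
apply: markov_sum => [z acc|z|z]; last exact: born_prob_ge0.
  by rewrite mulrC ler_pdivlMr// mul1r.
by rewrite mulr_ge0 ?invr_ge0// ltW// weight_pow_gt0.
Qed.

Lemma state_reject_le :
  \sum_(z | ~~ accepts z) outcome_prob (kronf (vpow v) (vpow u)) (tpow rho m) z
  <= (t * tilted_mass (kronf v u) rho g) ^+ m.
Proof.
have tm_gt0 : 0 < t ^+ m by rewrite exprn_gt0.
have -> : (t * tilted_mass (kronf v u) rho g) ^+ m
    = \sum_(z : {ffun 'I_m -> X} * {ffun 'I_m -> Y})
      t ^+ m / weight_pow g z * weight_pow (outcome_prob (kronf v u) rho) z.
  rewrite exprMn -[m in _ ^+ m * _ ^+ m]card_ord -[X in _ * X]prodr_const.
  rewrite (prod_sum_pair (fun _ p => outcome_prob _ rho p / g p)) mulr_sumr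
    card_ord.
  by apply: eq_bigr => z _; rewrite big_split prodfV mulrAC mulrA.
under eq_bigr do rewrite (outcome_prob_tpow _ _ _ state_rho.1).
apply: markov_sum => z.
- by rewrite -ltNge => /ltW; rewrite ler_pdivlMr ?weight_pow_gt0// mul1r.
- by rewrite divr_ge0 ?ltW// weight_pow_gt0.
- by rewrite prodr_ge0// => k _; exact/outcome_prob_ge0/state_rho.1.
Qed.

Theorem LOCC_maxent_tnorm_ge (D : finType)
    (Lam : bop D D -> bop {ffun 'I_m -> A} {ffun 'I_m -> B}) : LOCC Lam ->
  1 - (t * tilted_mass (kronf v u) rho g) ^+ m - t ^- m * #|D|%:R
  <= tnorm (Lam (maxent D) - tpow rho m).
Proof.
move=> locc.
have F_frame := parseval_kronf (parseval_vpow m v_frame)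
  (parseval_vpow m u_frame).
set F := kronf _ _ in F_frame.
have Lam_accept_le := LOCC_maxent_test_le locc product_accept_le.
have state_rhom := is_state_tpow m state_rho.
have rho_total := sum_outcome_prob F_frame state_rhom.2.
rewrite (bigID accepts) /= in rho_total.
have herm_diff : hermitian (Lam (maxent D) - tpow rho m).
  by apply: LOCC_hermitianB => //; [exact: adjm_outer|exact: state_hermitian].
apply: le_trans (normr_sum_outcome_prob_le_tnorm accepts F_frame herm_diff).
rewrite ler_normr; apply/orP; right.
have -> : \sum_(z | accepts z) outcome_prob F (Lam (maxent D) - tpow rho m) z
    = \sum_(z | accepts z) outcome_prob F (Lam (maxent D)) z
      - \sum_(z | accepts z) outcome_prob F (tpow rho m) z.
  by rewrite -sumrB; apply: eq_bigr => z _; rewrite /outcome_prob qformB raddfB.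
have := state_reject_le; lra.
Qed.

End Test.

Lemma rate_le_strong_converse (A B A' B' : finType) (rho : bop A B)
    (sigma : bop A' B') (c : R) (err : nat -> R) :
  err @ \oo --> 0 ->
  (forall n m (Lam : bop {ffun 'I_n -> A} {ffun 'I_n -> B}
                     -> bop {ffun 'I_m -> A'} {ffun 'I_m -> B'}),
     LOCC Lam -> c * n%:R <= m%:R ->
     1 - err n <= tnorm (Lam (tpow rho n) - tpow sigma m)) ->
  (rate rho sigma <= c%:E)%E.
Proof.
move=> err_to0 far.
apply: ge_ereal_sup => _ [r [_ [m [Lam [locc [m_ratio fidel]]]]] <-].
rewrite lee_fin leNgt; apply/negP => c_lt_r.
suff : (1 : R) <= 0 by rewrite ler10.
have err_to1 : (fun n => 1 - err n) @ \oo --> (1 : R).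
  by rewrite -[X in _ --> X]subr0; apply: cvgB => //; exact: cvg_cst.
apply: (ler_cvg_to err_to1 fidel); near=> n; apply: far => //.
have n_gt0 : (0 < n)%N by near: n; exact: nbhs_infty_gt.
have : c < (m n)%:R / n%:R by near: n; exact: (cvgr_gt _ m_ratio).
by rewrite ltr_pdivlMr ?ltr0n// => /ltW.
Unshelve. all: by end_near. Qed.

Lemma exists_exprn_gt (c t : R) : 1 < t -> exists2 l, (0 < l)%N & c < t ^+ l.
Proof.
move=> t_gt1; have t_gt0 : 0 < t by lra.
have max_gt0 : 0 < Num.max c 1 by rewrite lt_max ltr01 orbT.
have tV_to0 : (GRing.exp t^-1) @ \oo --> (0 : R).
  by apply: cvg_expr; rewrite gtr0_norm ?invr_gt0// invf_lt1.
near \oo => l; exists l; first by near: l; exact: nbhs_infty_gt.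
have : t^-1 ^+ l < (Num.max c 1)^-1.
  by near: l; apply: (cvgr_lt _ tV_to0); rewrite invr_gt0.
by rewrite exprVn ltf_pV2 ?posrE ?exprn_gt0// gt_max => /andP[].
Unshelve. all: by end_near. Qed.

Theorem rate_psi_plus_lty (A B : finType) (rho : bop A B) :
  entangled rho -> (rate psi_plus rho < +oo)%E.
Proof.
move=> ent_rho; have [state_rho _] := ent_rho; have [psd_rho rho1] := state_rho.
have [X [Y [v [u [g [v_frame u_frame g_gt0 g_bounded]]]]]] :=
  entangled_tilt ent_rho.
set a := tilted_mass _ _ _ => a_lt1.
have a_ge0 : 0 <= a.
  by apply: sumr_ge0 => z _; rewrite divr_ge0 ?outcome_prob_ge0// ltW.
have [t t_gt1 ta_lt1] : exists2 t, 1 < t & t * a < 1.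
  exists (2 / (1 + a)); first by rewrite ltr_pdivlMr; lra.
  by rewrite mulrAC ltr_pdivrMr; lra.
have t_gt0 : 0 < t by lra.
have ta_ge0 : 0 <= t * a by rewrite mulr_ge0// ltW.
have [l l_gt0 tl_gt2] := exists_exprn_gt 2 t_gt1.
apply: le_lt_trans (ltry l%:R).
apply: (rate_le_strong_converse
  (err := fun n => (t * a) ^+ n + (2 / t ^+ l) ^+ n)).
  rewrite -[X in _ --> X](addr0 0); apply: cvgD; apply: cvg_expr;
    rewrite ger0_norm//.
    by rewrite ltr_pdivrMr ?mul1r// exprn_gt0.
  by rewrite divr_ge0// exprn_ge0// ltW.
rewrite psi_plusE => n m Lam locc.
rewrite -natrM ler_nat tpow_maxent => ln_le_m.
apply: le_trans
  (LOCC_maxent_tnorm_ge v_frame u_frame g_gt0 g_bounded state_rho t_gt0 locc).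
rewrite -/a card_ffun !card_ord natrX -addrA -opprD lerD2l lerN2 lerD//.
  have n_le_m : (n <= m)%N by apply: leq_trans ln_le_m; exact: leq_pmull.
  by apply: ler_wiXn2l => //; exact: ltW.
rewrite expr_div_n -exprM [leRHS]mulrC ler_wpM2r ?exprn_ge0// lef_pV2 ?posrE
  ?exprn_gt0//.
by rewrite ler_weXn2l// ltW.
Qed.

End HypothesisTest.

(** * Irreversibility *)

Local Open Scope ereal_scope.

(* With [r] the preparation rate, [r^-1] is the entanglement cost. *)
Lemma rate_bounds_reversibility (R : realType) (r : R) (d s : \bar R) :
  (0 < r)%R -> 0 <= d -> 0 <= s -> d * r%:E <= s -> r%:E * s <= r%:E ->
  [/\ s <= 1, 1 - s <= (r^-1%:E - d) * r%:E & 0 < 1 - s -> d < r^-1%:E].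
Proof.
move=> r_gt0 d_ge0 s_ge0 dr_le_s rs_le_r.
have s_le1 : s <= 1 by rewrite -(@lee_pmul2l _ r%:E)// mule1.
case: s s_ge0 s_le1 dr_le_s {rs_le_r} => [s| |] //= _ s_le1.
case: d d_ge0 => [d| |] //= _; last by rewrite gt0_mulye.
rewrite -EFinM !lee_fin !lte_fin => dr_le_s; split=> // [|s_lt1].
  by rewrite mulrBl mulVf ?gt_eqF// lerB.
by rewrite -(ltr_pM2r r_gt0) mulVf ?gt_eqF//; lra.
Qed.

Theorem theorem2 (R : realType) (A B : finType) (rho : bop R A B) :
  entangled rho ->
  [/\ E_D rho / E_c rho <= sym_ent rho,
      sym_ent rho <= 1,
      asym_ent rho <= E_b rho / E_c rho
    & 0 < asym_ent rho -> E_D rho < E_c rho].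
Proof.
move=> ent_rho; have [state_rho _] := ent_rho.
have state_psi := is_state_psi_plus R.
have state_swap := is_state_swapop state_rho.
have swap_rate : rate psi_plus (swapop rho) = rate psi_plus rho.
  by rewrite -[in LHS]swapop_psi_plus rate_swap.
have distill_le : E_D rho * rate psi_plus rho <= sym_ent rho.
  by rewrite -swap_rate; exact: rate_trans.
have prepare_le : rate psi_plus rho * sym_ent rho <= rate psi_plus rho.
  by rewrite -[leRHS]swap_rate; exact: rate_trans.
have := rate_psi_plus_gt0 state_rho; have := rate_psi_plus_lty ent_rho.
rewrite /asym_ent /E_b /E_c.
case: (rate psi_plus rho) distill_le prepare_le => [r| |] // distill_le
  prepare_le _ r_gt0.
rewrite inver gt_eqF// inver invr_eq0 gt_eqF// invrK.
by have [|||] := rate_bounds_reversibility _ _ _ distill_le prepare_le;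
  rewrite ?rate_ge0.
Qed.
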